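(* Let $R\to S$ be a homomorphism of (not necessarily commutative) associative unital rings. View the $\mathfrak{Fin}$-ring $\coprod_RS:[n]\mapsto\coprod_{i=0}^n{}_R\,S$ as a cyclic module by restriction, and consider its associated normalized mixed complex $(N\coprod_RS,\mu,B)$. Then, under the identification $Q\Omega_RS\cong\coprod_RS$, the map $$l:(\Omega_RS,0,d)\to\Big(N\coprod_RS,\mu,B\Big),\qquad l(\omega)=\omega\otimes\sum_{\sigma\in S_n}\operatorname{sign}(\sigma)\,v_{\sigma1}\cdots v_{\sigma n}\quad(\omega\in\Omega^n_RS),$$ is an equivalence of mixed complexes.
   Context: $\mathfrak{Fin}$ is the category with objects $[n]=\{0,\dots,n\}$ and all set maps as morphisms. $\coprod_R$ is the coproduct of rings under $R$; in $\coprod_RS$ a set map $\alpha:[n]\to[m]$ sends the $i$-th copy of $S$ identically to the $\alpha(i)$-th copy. $\Omega_RS$ is the cochain DG-ring of relative noncommutative differential forms (Cuntz-Quillen): $\Omega^n_RS=S\otimes_R(S/R)^{\otimes_Rn}$, with $s_0\otimes\bar s_1\otimes\dots\otimes\bar s_n$ corresponding to $s_0ds_1\cdots ds_n$; it is the universal DG-ring under $R$ with a homomorphism of $R$-algebras from $S$ to its degree $0$ part. The functor $Q$: $V^n=\ker(\bigoplus_{i=0}^n\mathbb{Z}\to\mathbb{Z})$ (kernel of the sum map), with basis $v_1,\dots,v_n$, $v_i=e_i-e_0$ (so $v_0=0$), and $\alpha v_i=v_{\alpha(i)}-v_{\alpha(0)}$ for a set map $\alpha:[n]\to[m]$; $TV^n$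 is its tensor algebra. For a cochain DG-ring $A$, $QA$ is the $\mathfrak{Fin}$-ring $Q^nA=\bigoplus_{i\ge0}A^i\otimes T^iV^n$, with $\alpha(a\otimes x)=a\otimes\alpha x+da\otimes v_{\alpha(0)}\,\alpha x$ and product $(\omega\otimes x)\circ(\eta\otimes y)=\omega\eta\otimes xy+(-1)^{|x|}\omega\,d\eta\otimes\theta(x)y$, where $\theta$ is the degree $+1$ derivation of $TV^n$ with $\theta(v_i)=v_i^2$ and $\theta(xy)=\theta(x)y+(-1)^{|x|}x\theta(y)$. The identification $\coprod_RS\cong Q\Omega_RS$ is the isomorphism of $\mathfrak{Fin}$-rings sending $s$ in the $i$-th copy of $S$ to $s\otimes1+ds\otimes v_i$. Let $\partial_i:[n]\to[n+1]$ be the coface maps, $\mu_i:[n]\to[n-1]$ ($0\le i\le n-1$) the codegeneracies, $\mu_n:[n]\to[n-1]$ with $\mu_n(i)=i$ for $i<n$ and $\mu_n(n)=0$, and $t_n:[n]\to[n]$ the cyclic permutation $i\mapsto i+1$, $n\mapsto0$. A $\mathfrak{Fin}$-abelian group $C$ is a cyclic module with faces $d_i=\mu_i$ ($0\le i\le n$), degeneracies $s_j=\partial_{j+1}$ ($0\le j\le n$) and cyclic operators $t_n$; its normalized mixed complex $(NC,\mu,B)$ has $N_nC=C^n/\sum_{i=1}^n\partial_iC^{n-1}$, $\mu=\sum_{i=0}^n(-1)^i\mu_i$ and $B$ induced by $\partial_0\circ\sum_{i=0}^n(-1)^{ni}t_n^i$. A map of mixed complexes is an equivalence if it induces an isomorphism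 in Hochschild homology (homology of the degree $-1$ differential). $(\Omega_RS,0,d)$ is the mixed complex with zero degree $-1$ differential and degree $+1$ differential $d$. *)

(* Defs.v *)
From HB Require Import structures.
From mathcomp Require Import all_boot all_order all_fingroup all_algebra.
From mathcomp Require Import finmap monalg boolp zify.

Set Implicit Arguments.
Unset Strict Implicit.
Unset Printing Implicit Defensive.

Import GRing.Theory.
Local Open Scope ring_scope.
Local Open Scope quotient_scope.

(******************************************************************************)
(* All rings are associative and unital, possibly noncommutative and possibly *)
(* zero (pzRingType).                                                         *)
(******************************************************************************)

(** * Maps induced on quotients of abelian groups *)

Section QuotMap.
Variables (U V : zmodType) (I : zmodClosed U) (J : zmodClosed V).
Variables (f : {additive U -> V}) (fIJ : forall x, x \in I -> f x \in J).

Definition quot_map_fun (q : Quotient.quot I) : Quotient.quot J :=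
  \pi_(Quotient.quot J) (f (generic_quotient.repr q)).

Lemma quot_map_funE x : quot_map_fun (\pi_(Quotient.quot I) x) = \pi_(Quotient.quot J) (f x).
Proof.
apply/eqP; rewrite -Quotient.idealrBE -raddfB; apply: fIJ.
by rewrite Quotient.idealrBE reprK.
Qed.

Fact quot_map_subproof : zmod_morphism quot_map_fun.
Proof.
move=> p q; rewrite -[p]reprK -[q]reprK -raddfB !quot_map_funE.
by rewrite -raddfB -raddfB.
Qed.

Definition quot_map : {additive Quotient.quot I -> Quotient.quot J} :=
  HB.pack quot_map_fun
    (GRing.isZmodMorphism.Build _ _ quot_map_fun quot_map_subproof).

Lemma quot_mapE x : quot_map (\pi_(Quotient.quot I) x) = \pi_(Quotient.quot J) (f x).
Proof. exact: quot_map_funE. Qed.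

End QuotMap.

(** * Mixed complexes and Hochschild homology *)

Record mixedComplex := MixedComplex {
  mc_obj :> nat -> zmodType;
  mc_b : forall n, {additive mc_obj n.+1 -> mc_obj n};
  mc_B : forall n, {additive mc_obj n -> mc_obj n.+1};
  mc_bb : forall n x, mc_b n (mc_b n.+1 x) = 0;
  mc_BB : forall n x, mc_B n.+1 (mc_B n x) = 0;
  mc_bB0 : forall x, mc_b 0 (mc_B 0 x) = 0;
  mc_bB : forall n x, mc_b n.+1 (mc_B n.+1 x) + mc_B n (mc_b n x) = 0
}.

Record mixedMap (M N : mixedComplex) := MixedMap {
  mm_fun :> forall n, {additive M n -> N n};
  mm_b : forall n x, mm_fun n (mc_b M n x) = mc_b N n (mm_fun n.+1 x);
  mm_B : forall n x, mm_fun n.+1 (mc_B M n x) = mc_B N n (mm_fun n x)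
}.

Section Hochschild.
Variable M : mixedComplex.

Definition is_cycle n : {pred M n} :=
  match n return {pred M n} with
  | 0 => predT
  | m.+1 => fun x => mc_b M m x == 0
  end.

Fact is_cycle_closed n : zmod_closed (@is_cycle n).
Proof.
split; first by case: n => //= n; rewrite unfold_in /= raddf0.
case: n => //= n x y; rewrite !unfold_in /= => /eqP hx /eqP hy.
by rewrite raddfB hx hy subr0.
Qed.
HB.instance Definition _ n :=
  GRing.isZmodClosed.Build (M n) (@is_cycle n) (is_cycle_closed n).

Record cycles n := Cycle { cycle_val : M n; _ : cycle_val \in @is_cycle n }.

HB.instance Definition _ n := [isSub for @cycle_val n].
HB.instance Definition _ n := [Choice of cycles n by <:].
HB.instance Definition _ n := [SubChoice_isSubZmodule of cycles n by <:].

Definition is_boundary n : {pred cycles n} :=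
  fun z => `[< exists y, val z = mc_b M n y >].

Fact is_boundary_closed n : zmod_closed (@is_boundary n).
Proof.
split; first by apply/asboolP; exists 0; rewrite raddf0.
move=> x y /asboolP[u hu] /asboolP[v hv]; apply/asboolP.
by exists (u - v); rewrite raddfB -hu -hv raddfB.
Qed.
HB.instance Definition _ n :=
  GRing.isZmodClosed.Build (cycles n) (@is_boundary n) (is_boundary_closed n).

Definition HH n : zmodType := Quotient.quot (@is_boundary n).

End Hochschild.

Section HochschildMap.
Variables (M N : mixedComplex) (g : mixedMap M N).

Fact cycles_map_subproof n (z : cycles M n) : g n (val z) \in @is_cycle N n.
Proof.
have := valP z; move: (val z) => {z} x; case: n x => // n x /eqP hx.
by rewrite unfold_in /= -mm_b hx raddf0.
Qed.

Definition cycles_map_fun n (z : cycles M n) : cycles N n :=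
  Cycle (cycles_map_subproof z).

Fact cycles_map_additive n : zmod_morphism (@cycles_map_fun n).
Proof. by move=> x y; apply: val_inj; rewrite /= !raddfB. Qed.

Definition cycles_map n : {additive cycles M n -> cycles N n} :=
  HB.pack (@cycles_map_fun n)
    (GRing.isZmodMorphism.Build _ _ (@cycles_map_fun n) (@cycles_map_additive n)).

Fact cycles_map_boundary n z :
  z \in @is_boundary M n -> cycles_map n z \in @is_boundary N n.
Proof.
by move=> /asboolP[y hy]; apply/asboolP; exists (g _ y); rewrite /= hy mm_b.
Qed.

Definition HH_map n : {additive HH M n -> HH N n} :=
  quot_map (@cycles_map_boundary n).

End HochschildMap.

Definition mixed_equivalence (M N : mixedComplex) (g : mixedMap M N) : Prop :=
  forall n, bijective (HH_map g n).

(** * The category Fin, Fin-abelian groups and Fin-rings *)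

Definition fin_hom n m := {ffun 'I_n.+1 -> 'I_m.+1}.
Definition fin_id n : fin_hom n n := [ffun i => i].
Definition fin_comp n m p (b : fin_hom m p) (a : fin_hom n m) : fin_hom n p :=
  [ffun i => b (a i)].

Record finAb := FinAb {
  fa_obj :> nat -> zmodType;
  fa_map : forall n m, fin_hom n m -> {additive fa_obj n -> fa_obj m};
  fa_id : forall n x, fa_map (fin_id n) x = x;
  fa_comp : forall n m p (b : fin_hom m p) (a : fin_hom n m) x,
    fa_map (fin_comp b a) x = fa_map b (fa_map a x)
}.

Record finRing := FinRing {
  fr_obj :> nat -> pzRingType;
  fr_map : forall n m, fin_hom n m -> {rmorphism fr_obj n -> fr_obj m};
  fr_id : forall n x, fr_map (fin_id n) x = x;
  fr_comp : forall n m p (b : fin_hom m p) (a : fin_hom n m) x,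
    fr_map (fin_comp b a) x = fr_map b (fr_map a x)
}.

Definition finAb_of_finRing (P : finRing) : finAb :=
  @FinAb (fun n => P n) (fun n m a => fr_map P a) (@fr_id P) (@fr_comp P).

Definition coface n (i : 'I_n.+2) : fin_hom n n.+1 := [ffun k => lift i k].

(* For i <= n this is the i-th codegeneracy; the last one, i = n.+1, sends    *)
(* n.+1 to 0 and fixes the other points.                                      *)
Definition codegen n (i : 'I_n.+2) : fin_hom n.+1 n :=
  [ffun k : 'I_n.+2 =>
     inord (if i == ord_max then (if k == ord_max then 0%N else k)
            else if (k <= i)%N then k : nat else k.-1)].

Definition cyc n : fin_hom n n := [ffun k => ordS k].

(** * The normalized mixed complex of a Fin-abelian group *)

(* C is a cyclic module with faces codegen i, degeneracies coface j with      *)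
(* j != 0, and cyclic operators cyc; coface ord0 is the extra degeneracy.     *)

Section Normalized.
Variable C : finAb.

Definition degenerate n : {pred C n} :=
  match n return {pred C n} with
  | 0 => fun x => x == 0
  | m.+1 => fun x => `[< exists y : 'I_m.+1 -> C m,
              x = \sum_(i < m.+1) fa_map C (coface (lift ord0 i)) (y i) >]
  end.

Fact degenerate_closed n : zmod_closed (@degenerate n).
Proof.
case: n => [|n]; split; rewrite ?unfold_in //=.
- by move=> x y; rewrite !unfold_in /= => /eqP-> /eqP->; rewrite subr0.
- apply/asboolP; exists (fun _ => 0); rewrite big1 // => i _; exact: raddf0.
- move=> x y /asboolP[u ->] /asboolP[v ->]; apply/asboolP.
  by exists (fun i => u i - v i); rewrite -sumrB; apply: eq_bigr=> i _; rewrite raddfB.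
Qed.
HB.instance Definition _ n :=
  GRing.isZmodClosed.Build (C n) (@degenerate n) (degenerate_closed n).

Definition normalized n : zmodType := Quotient.quot (@degenerate n).

Definition chain_b_fun n (x : C n.+1) : C n :=
  \sum_(i < n.+2) fa_map C (codegen i) x *~ (-1) ^+ i.

Definition cyc_norm n (x : C n) : C n :=
  \sum_(i < n.+1) iter i (fa_map C (cyc n)) x *~ (-1) ^+ (n * i).

Definition chain_B_fun n (x : C n) : C n.+1 :=
  fa_map C (coface ord0) (cyc_norm x).

Arguments degenerate : simpl never.

Fact chain_b_additive n : zmod_morphism (@chain_b_fun n).
Proof.
move=> x y; rewrite /chain_b_fun -sumrB; apply: eq_bigr => i _.
by rewrite raddfB mulrzBl.
Qed.
Definition chain_b n : {additive C n.+1 -> C n} :=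
  HB.pack (@chain_b_fun n)
    (GRing.isZmodMorphism.Build _ _ (@chain_b_fun n) (@chain_b_additive n)).

Lemma iter_cycE n i x : iter i (fa_map C (cyc n)) x =
  fa_map C [ffun k : 'I_n.+1 => inZp (k + i) : 'I_n.+1] x.
Proof.
elim: i => [|i IH] /=.
  rewrite -[LHS]fa_id; congr (fa_map C _ x); apply/ffunP=> k.
  by rewrite !ffunE; apply: val_inj; rewrite /= addn0 modn_small.
rewrite IH -fa_comp; congr (fa_map C _ x); apply/ffunP=> k.
rewrite !ffunE; apply: val_inj => /=.
by rewrite -addn1 modnDml addn1 addnS.
Qed.

Lemma iter_cyc_additive n i :
  zmod_morphism (fun x => iter i (fa_map C (cyc n)) x).
Proof. by move=> x y; rewrite !iter_cycE raddfB. Qed.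

Fact chain_B_additive n : zmod_morphism (@chain_B_fun n).
Proof.
move=> x y; rewrite /chain_B_fun -raddfB; congr (fa_map C _ _).
rewrite /cyc_norm -sumrB; apply: eq_bigr => i _.
by rewrite iter_cyc_additive mulrzBl.
Qed.
Definition chain_B n : {additive C n -> C n.+1} :=
  HB.pack (@chain_B_fun n)
    (GRing.isZmodMorphism.Build _ _ (@chain_B_fun n) (@chain_B_additive n)).

Lemma codegenE n (i k : 'I_n.+2) : codegen i k =
  (if i == n.+1 :> nat then (if k == n.+1 :> nat then 0 else k)
   else if k <= i then k : nat else k.-1)%N :> nat.
Proof.
have := ltn_ord i; have := ltn_ord k => hk hi.
rewrite ffunE -!val_eqE inordK //=; repeat case: ifP; lia.
Qed.

Lemma cofaceE n (i : 'I_n.+2) k :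
  coface i k = (if i <= k then k.+1 else k)%N :> nat.
Proof. by rewrite ffunE /= /bump; case: leqP. Qed.

Lemma lift0E n (i : 'I_n) : lift ord0 i = i.+1 :> nat.
Proof. by []. Qed.

Lemma compE n m p (b : fin_hom m p) (a : fin_hom n m) k : fin_comp b a k = b (a k).
Proof. by rewrite ffunE. Qed.

(* A map that misses a nonzero point has degenerate image. *)
Lemma degenerate_miss m n (a : fin_hom m n.+1) (k : 'I_n.+2) x :
  k != ord0 -> (forall i, a i != k) -> fa_map C a x \in @degenerate n.+1.
Proof.
move=> k0 ak.
have [k' kk'] : exists k', k = lift ord0 k'.
  by case: (unliftP ord0 k) k0 => [k' ->|->]; [exists k' | rewrite eqxx].
have -> : a = fin_comp (coface k) [ffun i => odflt ord0 (unlift k (a i))].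
  apply/ffunP=> i; rewrite !ffunE.
  by case: unliftP (ak i) => [j ->|->] //=; rewrite eqxx.
rewrite fa_comp; apply/asboolP.
set y := fa_map C _ x.
exists (fun i => if i == k' then y else 0).
rewrite (bigD1 k') //= eqxx big1 ?addr0 ?kk' // => i /negbTE->; exact: raddf0.
Qed.

Lemma mulrz_closed n (x : C n) z :
  x \in @degenerate n -> x *~ z \in @degenerate n.
Proof. by move=> hx; rewrite rpredMz. Qed.

Lemma codegen_coface n (i : 'I_n.+2) (j : 'I_n.+1) :
  val i = val j \/ val i = j.+1 ->
  fin_comp (codegen i) (coface (lift ord0 j)) = fin_id n.
Proof.
move=> h; apply/ffunP=> k; rewrite compE [RHS]ffunE; apply: val_inj.
rewrite /= codegenE !cofaceE !lift0E; have := ltn_ord k; have := ltn_ord j.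
have := ltn_ord i; move: h => /=; repeat case: ifP; lia.
Qed.

Fact chain_b_degenerate n x :
  x \in @degenerate n.+1 -> chain_b n x \in @degenerate n.
Proof.
move=> /asboolP[y ->] {x}; rewrite raddf_sum; apply: rpred_sum => j _.
rewrite /= /chain_b_fun (bigD1 (widen_ord (leqnSn _) j)) //=.
rewrite (bigD1 (lift ord0 j)) /=; last by rewrite -val_eqE /= /bump; lia.
rewrite addrA -!fa_comp !codegen_coface /=; [|by right|by left].
rewrite fa_id /bump /= add1n exprS mulN1r mulrNz subrr add0r.
apply: rpred_sum => i /andP[]; rewrite -!val_eqE /= /bump /= add1n => ij ij'.
apply: mulrz_closed; rewrite -fa_comp.
case: n i j y ij ij' => [|n] i j y ij ij'.
  by have := ltn_ord i; have := ltn_ord j; lia.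
have jle := ltn_ord j; have ile := ltn_ord i.
apply: (@degenerate_miss _ _ _ (inord (if (i < j)%N then j : nat else j.+1))).
  by rewrite -val_eqE /= inordK; case: ifP; lia.
move=> k; have hk := ltn_ord k; rewrite compE -val_eqE /= codegenE !cofaceE.
rewrite !lift0E inordK; repeat case: ifP; lia.
Qed.

Fact chain_B_degenerate n x :
  x \in @degenerate n -> chain_B n x \in @degenerate n.+1.
Proof.
case: n x => [|n] x; first by move=> /eqP->; rewrite raddf0 rpred0.
move=> /asboolP[y ->] {x}; rewrite raddf_sum; apply: rpred_sum => j _.
rewrite /= /chain_B_fun /cyc_norm raddf_sum; apply: rpred_sum => i _.
rewrite raddfMz; apply: mulrz_closed; rewrite iter_cycE -!fa_comp.
apply: (@degenerate_miss _ _ _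
  (lift ord0 (inZp (lift ord0 j + i) : 'I_n.+2))) => // k.
rewrite !ffunE (inj_eq lift_inj) -val_eqE /=.
have := ltn_ord j; have := ltn_ord k => hk hj.
by rewrite eqn_modDr !modn_small /bump; lia.
Qed.

Lemma codegen_codegen n (i : 'I_n.+2) (j : 'I_n.+3) : (j <= i)%N ->
  fin_comp (codegen i) (codegen j) =
  fin_comp (codegen (inord j)) (codegen (lift ord0 i)).
Proof.
move=> h; apply/ffunP=> k; have hi := ltn_ord i; have hj := ltn_ord j.
have hk := ltn_ord k; rewrite !compE; apply: val_inj; rewrite /= !codegenE.
rewrite lift0E inordK; last lia.
repeat case: ifP; lia.
Qed.

Lemma chain_bb n x : chain_b n (chain_b n.+1 x) = 0.
Proof.
rewrite /= /chain_b_fun.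
pose F (p : 'I_n.+2 * 'I_n.+3) : C n :=
  fa_map C (fin_comp (codegen p.1) (codegen p.2)) x *~ (-1) ^+ (p.1 + p.2).
have -> : \sum_(i < n.+2) fa_map C (codegen i)
    (\sum_(j < n.+3) fa_map C (codegen j) x *~ (-1) ^+ j) *~ (-1) ^+ i =
  \sum_p F p.
  rewrite -(pair_bigA _ (fun i j => F (i, j))) /=; apply: eq_bigr => i _.
  rewrite raddf_sum mulrz_suml; apply: eq_bigr => j _ /=.
  by rewrite /F /= raddfMz -mulrzA -exprD fa_comp addnC.
rewrite (bigID (fun p : 'I_n.+2 * 'I_n.+3 => (p.2 <= p.1)%N)) /=.
pose h (p : 'I_n.+2 * 'I_n.+3) : 'I_n.+2 * 'I_n.+3 := (inord p.2, inord p.1.+1).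
pose h' (p : 'I_n.+2 * 'I_n.+3) : 'I_n.+2 * 'I_n.+3 := (inord p.2.-1, inord p.1).
rewrite [X in _ + X](reindex_onto h h') /=; last first.
  move=> [i j] /=; have := ltn_ord i; have := ltn_ord j => hj hi hij.
  by rewrite /h /h' /=; congr (_, _); apply: val_inj; rewrite /= !inordK; lia.
rewrite [X in _ + X](eq_bigl (fun p : 'I_n.+2 * 'I_n.+3 => (p.2 <= p.1)%N)).
  rewrite -big_split big1 //= => -[i j] /= hji; rewrite /F /h /=.
  have := ltn_ord i; have := ltn_ord j => hj hi.
  rewrite (codegen_codegen hji) !inordK ?ltnS; try lia.
  have -> : lift ord0 i = inord i.+1 by apply: val_inj; rewrite /= inordK //.
  by rewrite addnS addnC exprS mulN1r mulrNz subrr.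
move=> [i j]; have := ltn_ord i; have := ltn_ord j => /= hj hi.
rewrite /h /h' xpair_eqE -!val_eqE /=.
case: (leqP j i) => hij; first by rewrite !inordK; lia.
case: (ltnP j n.+2) => hj2; first by rewrite !inordK; lia.
have -> : j = n.+2 :> nat by lia.
have -> : inord n.+2 = ord0 :> 'I_n.+2.
  by rewrite /inord /insubd insubN //= ltnn.
by rewrite !andbA andbC !inordK.
Qed.

Lemma chain_BB n x : chain_B n.+1 (chain_B n x) \in @degenerate n.+2.
Proof.
rewrite /= /chain_B_fun {1}/cyc_norm raddf_sum; apply: rpred_sum => i _.
rewrite raddfMz; apply: mulrz_closed; rewrite iter_cycE -!fa_comp.
apply: (@degenerate_miss _ _ _ (lift ord0 (inZp i : 'I_n.+2))) => // k.
rewrite !ffunE (inj_eq lift_inj) -val_eqE /=.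
rewrite -{2}[i : nat]add0n eqn_modDr !modn_small ?ltn_ord //.
exact: (@ltn_ord _ (lift ord0 k)).
Qed.


Definition rot n (i : nat) : fin_hom n n := [ffun k : 'I_n.+1 => inZp (k + i)].

Lemma rotE n i (k : 'I_n.+1) : (i <= n.+1)%N ->
  rot n i k = (if k + i <= n then k + i else k + i - n.+1)%N :> nat.
Proof.
move=> hi; have hk := ltn_ord k; rewrite ffunE /=; case: leqP => h.
  by rewrite modn_small.
have -> : (k + i)%N = (k + i - n.+1 + n.+1)%N by lia.
by rewrite modnDr modn_small; lia.
Qed.

Lemma iter_rotE n i x : iter i (fa_map C (cyc n)) x = fa_map C (rot n i) x.
Proof. exact: iter_cycE. Qed.

Lemma cyc_cyc_norm n (x : C n) :
  fa_map C (cyc n) (cyc_norm x) *~ (-1) ^+ n = cyc_norm x.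
Proof.
rewrite /cyc_norm raddf_sum mulrz_suml big_ord_recr [RHS]big_ord_recl /= addrC.
congr (_ + _).
  rewrite raddfMz -iterS -mulrzA -exprD iter_rotE muln0 mulr1z.
  have -> : rot n n.+1 = fin_id n.
    apply/ffunP=> k; apply: val_inj; rewrite /= rotE // [fin_id n k]ffunE.
    by have := ltn_ord k; case: ifP; lia.
  by rewrite fa_id -mulnSr -signr_odd oddM /= andbN.
apply: eq_bigr => i _.
by rewrite raddfMz -mulrzA -exprD -mulnSr.
Qed.

Lemma codegen_rot_nat (n i j k : nat) : (i < n.+2 -> j < n.+1 -> k < n.+2 ->
 let s := if k + i <= n.+1 then k + i else k + i - n.+2 in
 let q := if i <= j then i else i.-1 in
 let p := if i <= j then j - i else n.+1 - i + j.+1 in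
 let u := (if p == n.+1 then (if k == n.+1 then 0 else k) else if k <= p then k else k.-1) in
 (if j == n.+1 then (if s == n.+1 then 0 else s) else if s <= j then s else s.-1) =
 (if u + q <= n then u + q else u + q - n.+1))%N.
Proof.
move=> hi hj hk s q p u.
have -> : (j == n.+1)%N = false by lia.
rewrite /u /q /p /s {u q p s}.
case: (leqP i j) => hij.
  have -> : (j - i == n.+1)%N = false by lia.
  case: (leqP k (j - i)%N) => h1; case: (leqP (k + i)%N n.+1) => h2; case: ifP; case: ifP; lia.
case: eqP => e1; first by case: eqP => e2; case: (leqP (k + i)%N n.+1) => h2; case: ifP; case: ifP; lia.
by case: (leqP k (n.+1 - i + j.+1)%N) => h1; case: (leqP (k + i)%N n.+1) => h2; case: ifP; case: ifP; lia.
Qed.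

Lemma b'_cyc_norm n (x : C n.+1) :
  \sum_(j < n.+1) fa_map C (codegen (widen_ord (leqnSn _) j)) (cyc_norm x)
    *~ (-1) ^+ j = cyc_norm (chain_b n x).
Proof.
pose F (p : 'I_n.+1 * 'I_n.+2) : C n :=
  fa_map C (fin_comp (codegen (widen_ord (leqnSn _) p.1)) (rot _ p.2)) x
    *~ (-1) ^+ (p.1 + n.+1 * p.2).
pose G (p : 'I_n.+1 * 'I_n.+2) : C n :=
  fa_map C (fin_comp (rot _ p.1) (codegen p.2)) x *~ (-1) ^+ (n * p.1 + p.2).
transitivity (\sum_p F p).
  rewrite -(pair_bigA _ (fun i j => F (i, j))) /=; apply: eq_bigr => i _.
  rewrite /cyc_norm raddf_sum mulrz_suml; apply: eq_bigr => j _ /=.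
  by rewrite /F /= raddfMz iter_rotE -mulrzA -exprD fa_comp addnC.
transitivity (\sum_p G p); last first.
  rewrite -(pair_bigA _ (fun i j => G (i, j))) /=; apply: eq_bigr => i _.
  rewrite iter_rotE /= /chain_b_fun raddf_sum mulrz_suml.
  apply: eq_bigr => j _ /=.
  by rewrite /G /= raddfMz -mulrzA -exprD fa_comp addnC.
pose h (p : 'I_n.+1 * 'I_n.+2) : 'I_n.+1 * 'I_n.+2 :=
  if (p.2 <= p.1)%N then (inord p.2, inord (p.1 - p.2))
  else (inord p.2.-1, inord (n.+1 - p.2 + p.1.+1)).
have hE p : (h p).1 = (if p.2 <= p.1 then p.2 : nat else p.2.-1)%N :> nat /\
  (h p).2 = (if p.2 <= p.1 then p.1 - p.2 else n.+1 - p.2 + p.1.+1)%N :> nat.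
  case: p => j i; have hj := ltn_ord j; have hi := ltn_ord i.
  by rewrite /h /=; case: leqP => hij /=; rewrite !inordK; lia.
have h_inj : injective h.
  move=> p q hpq; have [p1 p2] := hE p; have [q1 q2] := hE q.
  rewrite hpq in p1 p2; move: p q p1 p2 q1 q2 {hpq} => [j i] [j' i'] /=.
  have hj := ltn_ord j; have hi := ltn_ord i.
  have hj' := ltn_ord j'; have hi' := ltn_ord i' => p1 p2 q1 q2.
  suff [] : j = j' :> nat /\ i = i' :> nat by move=> /val_inj-> /val_inj->.
  by move: p1 p2 q1 q2; case: ifP; case: ifP; lia.
rewrite [RHS](reindex_inj h_inj) /=; apply: eq_bigr => p _; rewrite /F /G.
have [h1 h2] := hE p; case: p h1 h2 => j i /= h1 h2.
have hj := ltn_ord j; have hi := ltn_ord i; congr (fa_map C _ x *~ _).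
  apply/ffunP=> k; have hk := ltn_ord k; rewrite !compE; apply: val_inj.
  have h1' : ((h (j, i)).1 <= n.+1)%N := ltnW (ltn_ord _).
  rewrite /= codegenE (rotE _ (ltnW hi)) (rotE _ h1') codegenE.
  by rewrite h1 h2; apply: codegen_rot_nat.
rewrite -[LHS]signr_odd -[RHS]signr_odd h1 h2; congr (_ ^+ nat_of_bool _).
case: leqP => hij; first by rewrite oddD oddM oddD oddB // oddM /=; lia.
have [i' ei] : exists i', i = i'.+1 :> nat by exists i.-1; lia.
rewrite ei /= in hij *; rewrite subSS.
rewrite !(oddD, oddM) oddB /=; last by lia.
by case: (odd n); case: (odd i'); case: (odd j).
Qed.

Lemma chain_bB0 x : chain_b 0 (chain_B 0 x) = 0.
Proof.
rewrite /= /chain_b_fun /chain_B_fun /cyc_norm !big_ord_recl !big_ord0 /=.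
rewrite !addr0 mulr1z mulrNz mulr1z -!fa_comp; apply/eqP; rewrite subr_eq0.
apply/eqP; congr (fa_map C _ x); apply/ffunP=> k; apply: val_inj => /=.
by rewrite !ord1.
Qed.

Lemma chain_bB n x :
  chain_b n.+1 (chain_B n.+1 x) + chain_B n (chain_b n x) = 0.
Proof.
rewrite {1}/chain_b /= /chain_b_fun /chain_B_fun; set y := cyc_norm x.
rewrite big_ord_recl big_ord_recr /= -!fa_comp.
have -> : fin_comp (codegen ord0) (coface ord0) = fin_id n.+1.
  apply/ffunP=> k; have hk := ltn_ord k; apply: val_inj.
  by rewrite compE [X in _ = val X]ffunE /= codegenE cofaceE.
have -> : fin_comp (codegen (lift ord0 ord_max)) (coface ord0) = cyc n.+1.
  apply/ffunP=> k; have hk := ltn_ord k; apply: val_inj.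
  rewrite compE [X in _ = val X]ffunE /= codegenE cofaceE /= /bump /=.
  case: (ltnP k.+1 n.+2) => hk'; first by rewrite modn_small //; repeat case: ifP; lia.
  have -> : k = n.+1 :> nat by lia.
  by rewrite modnn; repeat case: ifP; lia.
rewrite fa_id -b'_cyc_norm -/y [X in _ + X]raddf_sum.
have -> : (-1) ^+ bump 0 n.+1 = (-1) ^+ n.+1 * -1 :> int.
  by rewrite /bump /= add1n exprSr.
rewrite mulrzA cyc_cyc_norm mulrNz mulr1z addrCA subrr addr0 -big_split big1 //= => i _; rewrite -fa_comp.
have -> : fin_comp (codegen (lift ord0 (widen_ord (leqnSn n.+1) i))) (coface ord0)
  = fin_comp (coface ord0) (codegen (widen_ord (leqnSn n.+1) i)).
  apply/ffunP=> k; have hk := ltn_ord k; have hi := ltn_ord i; apply: val_inj.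
  rewrite !compE /= codegenE !cofaceE codegenE lift0E /=.
  by repeat case: ifP; lia.
by rewrite raddfMz -fa_comp /bump /= add1n exprS mulN1r mulrNz addNr.
Qed.

Definition norm_b n : {additive normalized n.+1 -> normalized n} :=
  quot_map (@chain_b_degenerate n).

Definition norm_B n : {additive normalized n -> normalized n.+1} :=
  quot_map (@chain_B_degenerate n).

Fact norm_bb n x : norm_b n (norm_b n.+1 x) = 0.
Proof. by rewrite -[x]reprK !quot_mapE chain_bb raddf0. Qed.

Fact norm_BB n x : norm_B n.+1 (norm_B n x) = 0.
Proof.
rewrite -[x]reprK !quot_mapE; apply/eqP; rewrite -(raddf0 (\pi_(normalized n.+2))).
by rewrite -Quotient.idealrBE subr0 chain_BB.
Qed.

Fact norm_bB0 x : norm_b 0 (norm_B 0 x) = 0.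
Proof. by rewrite -[x]reprK !quot_mapE chain_bB0 raddf0. Qed.

Fact norm_bB n x : norm_b n.+1 (norm_B n.+1 x) + norm_B n (norm_b n x) = 0.
Proof. by rewrite -[x]reprK !quot_mapE -raddfD chain_bB raddf0. Qed.

Definition normalized_mixed : mixedComplex :=
  MixedComplex norm_bb norm_BB norm_bB0 norm_bB.

Definition norm_class n (x : C n) : normalized_mixed n := \pi_(normalized n) x.

End Normalized.

(** * Cochain DG-rings *)

Record dgRing := DGRing {
  dg_ring :> pzRingType;
  dg_deg : nat -> zmodClosed dg_ring;
  dg_d : {additive dg_ring -> dg_ring};
  dg_one : 1 \in dg_deg 0;
  dg_mul : forall i j x y,
    x \in dg_deg i -> y \in dg_deg j -> x * y \in dg_deg (i + j);
  dg_span : forall x, exists N (c : nat -> dg_ring),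
    (forall i, c i \in dg_deg i) /\ x = \sum_(i < N) c i;
  dg_direct : forall N (c : nat -> dg_ring), (forall i, c i \in dg_deg i) ->
    \sum_(i < N) c i = 0 -> forall i, (i < N)%N -> c i = 0;
  dg_d_deg : forall i x, x \in dg_deg i -> dg_d x \in dg_deg i.+1;
  dg_dd : forall x, dg_d (dg_d x) = 0;
  dg_leibniz : forall i x y, x \in dg_deg i ->
    dg_d (x * y) = dg_d x * y + (-1) ^+ i * (x * dg_d y)
}.

Section Homogeneous.
Variable A : dgRing.

Record homog n := Homog { homog_val : A; _ : homog_val \in dg_deg A n }.

HB.instance Definition _ n := [isSub for @homog_val n].
HB.instance Definition _ n := [Choice of homog n by <:].
HB.instance Definition _ n := [SubChoice_isSubZmodule of homog n by <:].

Definition homog_d_fun n (x : homog n) : homog n.+1 :=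
  Homog (dg_d_deg (valP x)).

Fact homog_d_additive n : zmod_morphism (@homog_d_fun n).
Proof. by move=> x y; apply: val_inj; rewrite /= !raddfB. Qed.

Definition homog_d n : {additive homog n -> homog n.+1} :=
  HB.pack (@homog_d_fun n)
    (GRing.isZmodMorphism.Build _ _ (@homog_d_fun n) (@homog_d_additive n)).

Definition homog_0 n : {additive homog n.+1 -> homog n} := \0.

Fact homog_dd n x : homog_d n.+1 (homog_d n x) = 0.
Proof. by apply: val_inj; rewrite /= dg_dd. Qed.

Fact homog_d0 n x : homog_0 n.+1 (homog_d n.+1 x) + homog_d n (homog_0 n x) = 0.
Proof. by rewrite -[RHS](raddf0 (homog_d n)) -[RHS]add0r. Qed.

(* The mixed complex (A, 0, d). *)
Definition dg_mixed : mixedComplex :=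
  @MixedComplex homog homog_0 homog_d
    (fun _ _ => erefl) homog_dd (fun _ => erefl) homog_d0.

End Homogeneous.

(** * Relative noncommutative differential forms *)

Section Forms.
Variables (R S : pzRingType) (f : {rmorphism R -> S}).

Definition upd n (x : {ffun 'I_n.+1 -> S}) k s : {ffun 'I_n.+1 -> S} :=
  [ffun i => if i == k then s else x i].

(* The functions on S^(n+1) that factor through additive maps out of          *)
(* S (x)_R (S/R) (x)_R ... (x)_R (S/R), with n factors S/R: additive in each   *)
(* slot, R-balanced between consecutive slots, and zero as soon as a slot      *)
(* other than the zeroth one is in the image of R.                             *)
Record form_multimap n (M : zmodType) (m : {ffun 'I_n.+1 -> S} -> M) : Prop := {
  fm_add : forall x k s t, m (upd x k (s + t)) = m (upd x k s) + m (upd x k t);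
  fm_balanced : forall x (k : 'I_n) r,
    m (upd x (widen_ord (leqnSn n) k) (x (widen_ord (leqnSn n) k) * f r)) =
    m (upd x (lift ord0 k) (f r * x (lift ord0 k)));
  fm_norm : forall x (k : 'I_n) r, m (upd x (lift ord0 k) (f r)) = 0
}.

Variables (A : dgRing) (iota : {rmorphism S -> A}).

(* s_0 ds_1 ... ds_n *)
Definition form n (x : {ffun 'I_n.+1 -> S}) : A :=
  iota (x ord0) * \prod_(i < n) dg_d A (iota (x (lift ord0 i))).

(* (A, iota) is the DG-ring of relative forms of S over R: A is a DG-ring     *)
(* under R (with dR = 0), iota is a homomorphism of R-algebras from S to A^0,  *)
(* and (s_0, ..., s_n) |-> s_0 ds_1 ... ds_n exhibits A^n as the tensor        *)
(* product S (x)_R (S/R) (x)_R ... (x)_R (S/R).                                *)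
Record relative_forms : Prop := {
  rf_deg0 : forall s, iota s \in dg_deg A 0;
  rf_d : forall r, dg_d A (iota (f r)) = 0;
  rf_tensor : forall n (M : zmodType) (m : {ffun 'I_n.+1 -> S} -> M),
    form_multimap m ->
    exists2 g : {additive homog A n -> M},
      forall x w, val w = form x -> g w = m x &
      forall g' : {additive homog A n -> M},
        (forall x w, val w = form x -> g' w = m x) -> g' =1 g
}.

End Forms.

(** * The coproduct Fin-ring *)

(* For each n, P n with the maps in_n,0, ..., in_n,n : S -> P n is a coproduct *)
(* of n+1 copies of S in the category of rings under R; a set map a sends the  *)
(* i-th copy of S identically to the (a i)-th one.                             *)
Record coproduct_finRing (R S : pzRingType) (f : {rmorphism R -> S})
    (P : finRing) (inj : forall n, 'I_n.+1 -> {rmorphism S -> P n}) : Prop := {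
  cp_under : forall n i j r, inj n i (f r) = inj n j (f r);
  cp_univ : forall n (T : pzRingType) (u : {rmorphism R -> T})
      (g : 'I_n.+1 -> {rmorphism S -> T}),
    (forall i r, g i (f r) = u r) ->
    exists2 h : {rmorphism P n -> T},
      forall i s, h (inj n i s) = g i s &
      forall h' : {rmorphism P n -> T},
        (forall i s, h' (inj n i s) = g i s) -> h' =1 h;
  cp_map : forall n m (a : fin_hom n m) i s,
    fr_map P a (inj n i s) = inj m (a i) s
}.

(** * The tensor algebras TV^n and the Fin-ring QA *)

(* TV^n is the free associative ring on the basis v_1, ..., v_n of V^n; the    *)
(* letter v_(k+1) is the one indexed by k : 'I_n.                              *)
Definition TV n : nzRingType := {malg int[{fmonom 'I_n}]}.

Definition tv n (i : 'I_n.+1) : TV n :=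
  if unlift ord0 i is Some k then << fmu k >> else 0.

(* The ring map TV^n -> TV^m with v_i |-> v_(a i) - v_(a 0). *)
Definition tv_map n m (a : fin_hom n m) : TV n -> TV m :=
  mmap intr (fun w : {fmonom 'I_n} =>
    \prod_(k <- w) (tv (a (lift ord0 k)) - tv (a ord0))).

(* theta(v_k w) = v_k^2 w - v_k theta(w), as theta is the derivation of degree *)
(* +1 with theta(v_k) = v_k^2.                                                *)
Fixpoint theta_word n (w : seq 'I_n) : TV n :=
  if w is k :: w' then
    << fmu k >> * << fmu k >> * \prod_(l <- w') << fmu l >>
    - << fmu k >> * theta_word w'
  else 0.

Definition theta n : TV n -> TV n :=
  mmap intr (fun w : {fmonom 'I_n} => theta_word w).

Section Q.
Variable A : dgRing.

(* The abelian group A (x) TV^n, as finitely supported families of elements   *)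
(* of A indexed by the words in v_1, ..., v_n.                                 *)
Definition ATV n : zmodType := {malg A[{fmonom 'I_n}]}.

Definition tens n (a : A) (x : TV n) : ATV n :=
  \sum_(w <- msupp x) << a *~ x@_w *g w >>.

(* Q^n A, the direct sum of the A^i (x) T^i V^n, as a subgroup of A (x) TV^n. *)
Definition inQ n (q : ATV n) : Prop :=
  forall w : {fmonom 'I_n}, q@_w \in dg_deg A (size w).

Definition q_map n m (a : fin_hom n m) (q : ATV n) : ATV m :=
  \sum_(w <- msupp q)
    (tens q@_w (tv_map a << w >>)
     + tens (dg_d A q@_w) (tv (a ord0) * tv_map a << w >>)).

Definition q_mul n (p q : ATV n) : ATV n :=
  \sum_(x <- msupp p) \sum_(y <- msupp q)
    (tens (p@_x * q@_y) (<< x >> * << y >>)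
     + tens ((-1) ^+ size x * (p@_x * dg_d A q@_y)) (theta << x >> * << y >>)).

Definition q_one n : ATV n := tens 1 1.

(* The sum of sign(sigma) v_(sigma 1) ... v_(sigma n) over sigma in S_n. *)
Definition antisym n : TV n :=
  \sum_(s : 'S_n) (-1) ^+ s * \prod_(i < n) tv (lift ord0 (s i)).

(* phi is an isomorphism of Fin-rings from P to QA that sends s in the i-th   *)
(* copy of S to s (x) 1 + ds (x) v_i.                                          *)
Record Q_identification (S : pzRingType) (iota : {rmorphism S -> A})
    (P : finRing) (inj : forall n, 'I_n.+1 -> {rmorphism S -> P n})
    (phi : forall n, {additive P n -> ATV n}) : Prop := {
  qi_inQ : forall n x, inQ (phi n x);
  qi_inj : forall n, injective (phi n);
  qi_surj : forall n q, inQ q -> exists x, phi n x = q;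
  qi_one : forall n, phi n 1 = q_one n;
  qi_mul : forall n x y, phi n (x * y) = q_mul (phi n x) (phi n y);
  qi_map : forall n m (a : fin_hom n m) x,
    phi m (fr_map P a x) = q_map a (phi n x);
  qi_gen : forall n i s,
    phi n (inj n i s) = tens (iota s) 1 + tens (dg_d A (iota s)) (tv i)
}.

End Q.

(* Main.v *)
(* Write b for the alternating sum of the faces. The faces fix the point 0, so
   they act on A (x) TV^n through TV^n alone, by E_a (v_k x) = v_(a k) E_a x for
   pointed a. Splitting off the first letter of a word therefore gives
   operators that are defined and satisfy, before normalization,
     b h + h b = id - (empty word) - shuffle unshuffle,   unshuffle shuffle = id,
   where shuffle x = sum_q (-1)^q v_(q+1) E_(d_(q+1)) x is the shuffle product
   with the nondegenerate 1-simplex of the circle V, and both operators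
   anticommute with b. By induction on n every normalized cycle is homologous to
   a unique a (x) shuffle^n 1, and shuffle^n 1 is the antisymmetrizer. The same
   identity gives l d = B l: the cycle B (l w) has no room for a homotopy term,
   so it is the shuffle of its unshuffle, which is read off one coefficient.

   For the identification of the coproduct with Q, the ring Q^n receives the
   copies of S and hence a map from P n. An additive inverse sends
   s_0 ds_1 .. ds_m (x) v_(k_1) .. v_(k_m) to
   i_0(s_0) (i_(k_1) - i_0)(s_1) .. (i_(k_m) - i_0)(s_m); such products span P n,
   since i_k - i_0 is a derivation from i_0 to i_k. *)
Require Import Defs.
From HB Require Import structures.
From mathcomp Require Import all_boot all_order all_fingroup all_algebra.
From mathcomp Require Import finmap monalg boolp zify.

Set Implicit Arguments.
Unset Strict Implicit.
Unset Printing Implicit Defensive.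

Import GRing.Theory.
Local Open Scope ring_scope.

(** * The shuffle homotopy *)

(** The obstacle is that the face sum is not a derivation: every face is a ring map, acting on all
    letters of a word at once. So the homotopy looks at the first letter only. It replaces [v_k y]
    by minus the first [k] terms of the signed shuffle of [y], and the boundaries of these terms
    telescope to [v_k y]. Truncating at [k] is compatible with every face except the last one in the
    case where [v_k] is the top letter, which this face sends to [v_0 = 0]. That single failure is
    the term shuffle unshuffle, and it dictates the unshuffle: keep the words that begin with the
    top letter, drop this letter and apply the last face, which kills the words where it recurs.

    Normalization is handled by counting letters. An element is degenerate when each of its words
    misses some letter, so it suffices to follow how each operator changes the length of a word and
    its number of distinct letters. In particular the empty word is degenerate in every positive
    dimension. An unshuffle removes a letter but keeps the coefficient, so the induction on the
    dimension has to run over all gradings of the coefficients at once. *)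

(* [codegen i] on natural numbers. *)
Definition mu n i k :=
  (if i == n.+1 then (if k == n.+1 then 0 else k)
   else if k <= i then k else k.-1)%N.

Lemma signzK (V : zmodType) (x : V) k : x *~ (-1) ^+ k *~ (-1) ^+ k = x.
Proof. by rewrite -mulrzA -exprD addnn -signr_odd odd_double. Qed.

(* [T n] stands for TV^n and [E n m a] for the map induced by a pointed [a], with
   indices in [nat]; [v n k] is 0 for [k] out of range. *)
Section ShuffleHomotopy.
Variables (T : nat -> pzRingType) (v : forall n, nat -> T n).
Variable E : forall n m, (nat -> nat) -> {rmorphism T n -> T m}.
Hypothesis v0 : forall n, v n 0 = 0.
Hypothesis v_out : forall n k, (n < k)%N -> v n k = 0.
Hypothesis E_v : forall n m a k, (k <= n)%N -> a 0 = 0%N ->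
  E n m a (v n k) = v m (a k).
Hypothesis E_eq : forall n m a b x, (forall k, (k <= n)%N -> a k = b k) ->
  E n m a x = E n m b x.
Hypothesis E_comp : forall n m p b a x, (forall k, (k <= n)%N -> (a k <= m)%N) ->
  E m p b (E n m a x) = E n p (b \o a) x.
Hypothesis E_id : forall n a x, (forall k, (k <= n)%N -> a k = k) -> E n n a x = x.

Definition face_sum n (x : T n.+1) : T n :=
  \sum_(0 <= i < n.+2) E n.+1 n (mu n i) x *~ (-1) ^+ i.

Fact face_sum_additive n : zmod_morphism (@face_sum n).
Proof.
move=> x y; rewrite /face_sum -sumrB.
by apply: eq_bigr => q _; rewrite raddfB mulrzBl.
Qed.
HB.instance Definition _ n :=
  GRing.isZmodMorphism.Build _ _ (@face_sum n) (@face_sum_additive n).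

(* The homotopy is [v_k y |-> pshuffle k y]; for [k = n.+1], where [v_k = 0], this
   is minus the full shuffle. *)
Definition pshuffle n k (y : T n) : T n.+1 :=
  - \sum_(0 <= q < k) (v n.+1 q.+1 * E n n.+1 (bump q.+1) y) *~ (-1) ^+ q.

Fact pshuffle_additive n k : zmod_morphism (@pshuffle n k).
Proof.
move=> x y; rewrite /pshuffle -opprD -sumrB; congr (- _).
by apply: eq_bigr => q _; rewrite raddfB mulrBr mulrzBl.
Qed.
HB.instance Definition _ n k :=
  GRing.isZmodMorphism.Build _ _ (@pshuffle n k) (@pshuffle_additive n k).

Lemma pshuffle0 n y : @pshuffle n 0 y = 0.
Proof. by rewrite /pshuffle big_nil oppr0. Qed.

Lemma pshuffleS n k y : @pshuffle n k.+1 y =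
  pshuffle k y - (v n.+1 k.+1 * E n n.+1 (bump k.+1) y) *~ (-1) ^+ k.
Proof. by rewrite /pshuffle big_nat_recr //= opprD. Qed.

(** Faces [k] and [k.+1] undo the coface [bump k.+1] and leave [v_k y] and [v_(k+1) y], which
    telescope when summed over [k]. The other faces pass through the coface by the simplicial
    identities, those above it with index and sign shifted by one. *)
Lemma face_pshuffle_term n k (y : T n.+1) : (k <= n.+1)%N ->
  face_sum (v n.+2 k.+1 * E n.+1 n.+2 (bump k.+1) y) =
  (v n.+1 k * y - v n.+1 k.+1 * y) *~ (-1) ^+ k
  + \sum_(0 <= i < k)
      (v n.+1 k * E n n.+1 (bump k) (E n.+1 n (mu n i) y)) *~ (-1) ^+ i
  - \sum_(k.+1 <= i < n.+2)
      (v n.+1 k.+1 * E n n.+1 (bump k.+1) (E n.+1 n (mu n i) y)) *~ (-1) ^+ i.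
Proof.
move=> kn; rewrite /face_sum.
have term i : (i < n.+3)%N ->
  E n.+2 n.+1 (mu n.+1 i) (v n.+2 k.+1 * E n.+1 n.+2 (bump k.+1) y) =
  v n.+1 (mu n.+1 i k.+1) * E n.+1 n.+1 (mu n.+1 i \o bump k.+1) y.
  move=> hi; rewrite rmorphM /= E_v; [|lia|by rewrite /mu; repeat case: ifP; lia].
  by rewrite E_comp // => l hl; rewrite /bump; lia.
have mub j i : (j <= n.+1)%N -> (i <= n.+1)%N -> (mu n j i <= n)%N.
  by rewrite /mu; repeat case: ifP; lia.
rewrite (@big_cat_nat _ _ _ k) //=; last lia.
rewrite (@big_cat_nat _ _ _ k.+2 k) //=; try lia.
rewrite [X in _ + (X + _)]big_nat_recl // big_nat1.
rewrite big_add1 /= addrA; congr (_ + _).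
  rewrite addrC; congr (_ + _).
    rewrite !term; try lia.
    rewrite exprS mulN1r mulrNz mulrzBl; congr (_ * _ *~ _ - _ *~ _).
    - by congr v; rewrite /mu; repeat case: ifP; lia.
    - by apply: E_id => l hl; rewrite /mu /= /bump; repeat case: ifP; lia.
    - case: (ltnP k n.+1) => hk.
        congr (_ * _); first by congr v; rewrite /mu; repeat case: ifP; lia.
        by apply: E_id => l hl; rewrite /mu /= /bump; repeat case: ifP; lia.
      (* Here face [k.+1] is the wrap-around face, which sends the first letter to [v_0], while
         [v_(n+2)] is out of range on the right: both sides vanish. *)
      have -> : k = n.+1 by lia.
      by rewrite /mu !eqxx v0 v_out // !mul0r.
  apply: eq_big_nat => i /andP[_ hi]; rewrite term; last lia.
  rewrite E_comp; last by move=> l hl; apply: mub; lia.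
  congr (_ * _ *~ _); first by congr v; rewrite /mu; repeat case: ifP; lia.
  by apply: E_eq => l hl; rewrite /mu /= /bump; repeat case: ifP; lia.
rewrite -sumrN; apply: eq_big_nat => i /andP[hi hi']; rewrite term; last lia.
rewrite exprS mulN1r mulrNz; congr (- (_ * _ *~ _)).
  by congr v; rewrite /mu; repeat case: ifP; lia.
rewrite E_comp; last by move=> l hl; apply: mub; lia.
by apply: E_eq => l hl; rewrite /mu /= /bump; repeat case: ifP; lia.
Qed.

(* The index [if k <= i then k else k.-1] is [mu n i k] without the wrap-around of
   the last face. *)
Lemma face_pshuffle n k (y : T n.+1) : (k <= n.+2)%N ->
  face_sum (pshuffle k y) = v n.+1 k * y -
    \sum_(0 <= i < n.+2) pshuffle (if k <= i then k else k.-1)%N (E n.+1 n (mu n i) y) *~ (-1) ^+ i.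
Proof.
elim: k => [|k IH] hk.
  by rewrite pshuffle0 raddf0 v0 mul0r big1 ?subr0 // => i _; rewrite pshuffle0 mul0rz.
rewrite pshuffleS raddfB raddfMz /= IH ?face_pshuffle_term; try lia.
set z := fun i => E n.+1 n (mu n i) y.
rewrite (@big_cat_nat _ _ _ k) //=; last lia.
rewrite (@big_cat_nat _ _ _ k.+1 k) //= big_nat1.
rewrite [in RHS](@big_cat_nat _ _ _ k) //=; last lia.
rewrite [X in _ = _ - (_ + X)](@big_cat_nat _ _ _ k.+1 k) //= big_nat1 ltnn leqnn -/(z k).
(* Raising [k] by one lengthens the partial shuffle in every summand except [i = k]. The added terms
   are the two sums produced by [face_pshuffle_term]. *)
have -> : \sum_(0 <= i < k) pshuffle (if k < i then k.+1 else k)%N (z i) *~ (-1) ^+ i =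
  \sum_(0 <= i < k) pshuffle (if k <= i then k else k.-1)%N (z i) *~ (-1) ^+ i
  + (\sum_(0 <= i < k) (v n.+1 k * E n n.+1 (bump k) (z i)) *~ (-1) ^+ i) *~ (-1) ^+ k.
  rewrite mulrz_suml -big_split; apply: eq_big_nat => i /andP[_ hi] /=.
  have [-> ->] : (k < i)%N = false /\ (k <= i)%N = false by lia.
  case: k hi {IH hk} => // k hi /=.
  by rewrite pshuffleS mulrzBl exprS -!mulrzA mulN1r mulrN mulrNz (mulrC ((-1) ^+ k)).
have -> : \sum_(k.+1 <= i < n.+2) pshuffle (if k < i then k.+1 else k)%N (z i) *~ (-1) ^+ i =
  \sum_(k.+1 <= i < n.+2) pshuffle (if k <= i then k else k.-1)%N (z i) *~ (-1) ^+ i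
  - (\sum_(k.+1 <= i < n.+2) (v n.+1 k.+1 * E n n.+1 (bump k.+1) (z i)) *~ (-1) ^+ i) *~ (-1) ^+ k.
  rewrite mulrz_suml -sumrB; apply: eq_big_nat => i /andP[hi _] /=.
  rewrite hi (ltnW hi) /=.
  by rewrite pshuffleS mulrzBl -!mulrzA (mulrC ((-1) ^+ k)).
rewrite mulrzBl mulrzDl signzK -!/(z _) !opprD !opprK !addrA.
rewrite [LHS](ACl (1*5*6*2*7*3*4*8))%AC /= subrr add0r.
by [].
Qed.

(** [mu n i k] agrees with the index in [face_pshuffle] except at [i = k = n.+1], where it is [0]
    and not [n.+1]. The correction is this one missing summand. *)
Lemma homotopy_step n k (y : T n.+1) : (k <= n.+1)%N ->
  face_sum (pshuffle k y) +
    \sum_(0 <= i < n.+2) pshuffle (mu n i k) (E n.+1 n (mu n i) y) *~ (-1) ^+ i =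
  v n.+1 k * y - (if k == n.+1 then pshuffle n.+1 (E n.+1 n (mu n n.+1) y) *~ (-1) ^+ n.+1 else 0).
Proof.
move=> hk; rewrite face_pshuffle; last lia.
set A := \sum_(0 <= i < n.+2) _; set B := \sum_(0 <= i < n.+2) _.
set D := if _ then _ else _; suff -> : A = B + D.
  by rewrite -addrA opprD [- B - D]addrC -addrA addNr addr0.
rewrite /A /B /D; case: eqP => [->|/eqP kn]; last first.
  rewrite addr0; apply: eq_big_nat => i /andP[_ hi].
  by congr (pshuffle _ _ *~ _); rewrite /mu; repeat case: ifP; lia.
rewrite ![\sum_(0 <= i < n.+2) _]big_nat_recr //= leqnn.
have -> : mu n n.+1 n.+1 = 0%N by rewrite /mu !eqxx.
rewrite pshuffle0 mul0rz addr0; congr (_ + _).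
apply: eq_big_nat => i /andP[_ hi].
by congr (pshuffle _ _ *~ _); rewrite /mu; repeat case: ifP; lia.
Qed.

Definition shuffle n (y : T n) : T n.+1 := - pshuffle n.+1 y.

Fact shuffle_additive n : zmod_morphism (@shuffle n).
Proof. by move=> x y; rewrite /shuffle raddfB opprD. Qed.
HB.instance Definition _ n :=
  GRing.isZmodMorphism.Build _ _ (@shuffle n) (@shuffle_additive n).

Lemma shuffleE n (y : T n) : shuffle y =
  \sum_(0 <= q < n.+1) (v n.+1 q.+1 * E n n.+1 (bump q.+1) y) *~ (-1) ^+ q.
Proof. by rewrite /shuffle /pshuffle opprK. Qed.

(** This is [face_pshuffle] for [k = n.+2]: the leading [v_k] is out of range, and since every face
    index is below [k], each inner partial shuffle is a full one. *)
Lemma face_shuffle n (y : T n.+1) : face_sum (shuffle y) = - shuffle (face_sum y).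
Proof.
rewrite /shuffle raddfN /= face_pshuffle // v_out // mul0r sub0r; congr (- - _).
rewrite [in RHS]/face_sum raddf_sum; apply: eq_big_nat => i /andP[_ hi].
by rewrite raddfMz leqNgt hi.
Qed.

Lemma face_sum0 (x : T 1) : face_sum x = 0.
Proof.
rewrite /face_sum !big_nat_recl // big_geq // addr0 mulr1z mulrN1z.
rewrite (@E_eq _ _ _ (mu 0 1)) ?subrr // => k; rewrite /mu.
by repeat case: ifP; lia.
Qed.

(** The empty word and the words with a first letter span. On these, [h] is prescribed as the
    contraction, [eps] as the projection to the empty word, and [pi] as the unshuffle. *)
Hypothesis T_ext : forall n (M : zmodType) (F H : {additive T n -> M}), F 1 = H 1 ->
  (forall k y, (0 < k <= n)%N -> F (v n k * y) = H (v n k * y)) -> F =1 H.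
Variables (h : forall n, {additive T n -> T n.+1}) (eps : forall n, {additive T n -> T n}).
Variable pi : forall n, {additive T n.+1 -> T n}.
Hypothesis h1 : forall n, h n 1 = 0.
Hypothesis h_v : forall n k y, (0 < k <= n)%N -> h n (v n k * y) = pshuffle k y.
Hypothesis eps1 : forall n, eps n 1 = 1.
Hypothesis eps_v : forall n k y, (0 < k <= n)%N -> eps n (v n k * y) = 0.
Hypothesis pi1 : forall n, pi n 1 = 0.
Hypothesis pi_v : forall n k y, (0 < k <= n.+1)%N -> pi n (v n.+1 k * y) =
  if k == n.+1 then E n.+1 n (mu n n.+1) y *~ (-1) ^+ n else 0.

Lemma pi_v0 n k y : (k <= n.+1)%N -> pi n (v n.+1 k * y) =
  if k == n.+1 then E n.+1 n (mu n n.+1) y *~ (-1) ^+ n else 0.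
Proof. by case: k => [|k] hk; rewrite ?v0 ?mul0r ?raddf0 ?pi_v. Qed.

Lemma mu_le n i k : (i <= n.+1)%N -> (k <= n.+1)%N -> (mu n i k <= n)%N.
Proof. by rewrite /mu; repeat case: ifP; lia. Qed.

Lemma face_v n k y : (k <= n.+1)%N -> face_sum (v n.+1 k * y) =
  \sum_(0 <= i < n.+2) (v n (mu n i k) * E n.+1 n (mu n i) y) *~ (-1) ^+ i.
Proof.
move=> hk; apply: eq_big_nat => i /andP[_ hi].
by rewrite rmorphM /= E_v // /mu; case: ifP.
Qed.

Lemma homotopy n (x : T n.+1) :
  face_sum (h n.+1 x) + h n (face_sum x) = x - eps n.+1 x - shuffle (pi n x).
Proof.
pose F : {additive T n.+1 -> T n.+1} :=
  ((@face_sum _ \o h n.+1) \+ (h n \o @face_sum n))%R.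
pose H : {additive T n.+1 -> T n.+1} :=
  ((idfun \- eps n.+1) \- (@shuffle _ \o pi n))%R.
apply: (@T_ext _ _ F H _ _ x) => [|k y hk]; rewrite /F /H /=.
  rewrite h1 raddf0 eps1 subrr pi1 raddf0 subrr add0r /face_sum.
  rewrite raddf_sum big1 // => i _; by rewrite raddfMz rmorph1 /= h1 mul0rz.
rewrite h_v // eps_v // subr0 face_v; last lia.
rewrite raddf_sum (eq_big_nat _ _ (F2 := fun i =>
  pshuffle (mu n i k) (E n.+1 n (mu n i) y) *~ (-1) ^+ i)) => [|i /andP[_ hi]].
  rewrite homotopy_step; last lia.
  congr (_ - _); rewrite pi_v //; case: ifP => // _; last by rewrite raddf0.
  by rewrite exprS mulN1r mulrNz [RHS]raddfMz /= /shuffle [RHS]mulNrz.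
rewrite (raddfMz (h n)); congr (_ *~ _).
(* A face may send the first letter to [v_0 = 0]; the empty partial shuffle is also zero, so the
   rule for [h] persists. *)
case e: (mu n i k) => [|j]; first by rewrite v0 mul0r raddf0 pshuffle0.
by rewrite h_v // -e mu_le; lia.
Qed.

(** Only the last summand of the shuffle begins with the top letter. There the last face undoes the
    coface, and the two signs [(-1)^n] cancel. *)
Lemma pi_shuffle n (y : T n) : pi n (shuffle y) = y.
Proof.
rewrite shuffleE raddf_sum big_nat_recr //= raddfMz pi_v ?leqnn // eqxx.
rewrite big_nat_cond big1 ?add0r => [|i /andP[/andP[_ hi] _]]; last first.
  by rewrite raddfMz pi_v ?(ltn_eqF, mul0rz) //; lia.
rewrite signzK E_comp => [|k hk]; last by rewrite /bump; lia.
by apply: E_id => k hk; rewrite /mu /= /bump; repeat case: ifP; lia.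
Qed.

(** The first letter becomes [v_(n+1)] in two ways: from [v_(n+2)] under every face but the last,
    which gives the right side, and from [v_(n+1)] under the last two faces. The latter two terms
    have opposite signs and become equal after one more last face. *)
Lemma pi_face n (x : T n.+2) : pi n (face_sum x) = - face_sum (pi n.+1 x).
Proof.
pose F : {additive T n.+2 -> T n} := pi n \o @face_sum n.+1.
pose H : {additive T n.+2 -> T n} := \- (@face_sum n \o pi n.+1).
apply: (@T_ext _ _ F H _ _ x) => [|k y hk]; rewrite /F /H /=.
  rewrite pi1 raddf0 oppr0 /face_sum raddf_sum big1 // => i _.
  by rewrite raddfMz rmorph1 /= pi1 mul0rz.
rewrite face_v; last lia.
rewrite raddf_sum (eq_big_nat _ _ (F2 := fun i =>
  (if mu n.+1 i k == n.+1 then E n.+1 n (mu n n.+1) (E n.+2 n.+1 (mu n.+1 i) y) *~ (-1) ^+ n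
   else 0) *~ (-1) ^+ i)) => [|i /andP[_ hi]]; last first.
  by rewrite raddfMz pi_v0 // mu_le; lia.
rewrite pi_v //; case: eqP => [->|/eqP kn].
  rewrite big_nat_recr //=.
  have -> : mu n.+1 n.+2 n.+2 = 0%N by rewrite /mu !eqxx.
  rewrite mul0rz addr0 raddfMz exprS mulN1r mulrNz opprK /face_sum mulrz_suml.
  apply: eq_big_nat => i /andP[_ hi].
  have -> : mu n.+1 i n.+2 == n.+1 by rewrite /mu; repeat case: ifP; lia.
  rewrite -!mulrzA mulrC; congr (_ *~ _).
  rewrite !E_comp; try by move=> j hj; apply: mu_le; lia.
  by apply: E_eq => j hj; rewrite /= /mu; repeat case: ifP; lia.
rewrite raddf0 oppr0 2?big_nat_recr //= big_nat_cond big1 ?add0r; last first.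
  move=> i /andP[/andP[_ hi] _].
  have -> : (mu n.+1 i k == n.+1) = false by rewrite /mu; repeat case: ifP; lia.
  by rewrite mul0rz.
case: (eqVneq k n.+1) => [->|kn']; last first.
  have -> : (mu n.+1 n.+1 k == n.+1) = false by rewrite /mu; repeat case: ifP; lia.
  have -> : (mu n.+1 n.+2 k == n.+1) = false by rewrite /mu; repeat case: ifP; lia.
  by rewrite !mul0rz addr0.
have -> : mu n.+1 n.+1 n.+1 == n.+1 by rewrite /mu; repeat case: ifP; lia.
have -> : mu n.+1 n.+2 n.+1 == n.+1 by rewrite /mu; repeat case: ifP; lia.
rewrite !E_comp; try by move=> j hj; apply: mu_le; lia.
rewrite (@E_eq _ _ _ (mu n n.+1 \o mu n.+1 n.+2)) => [|j hj].
  by rewrite [(-1) ^+ n.+2]exprS mulN1r mulrNz subrr.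
by rewrite /= /mu; repeat case: ifP; lia.
Qed.

End ShuffleHomotopy.

(** * Tensor algebras as a Fin-ring *)

Lemma malg_additive_ext (K : choiceType) (G M : zmodType)
    (F H : {additive {malg G[K]} -> M}) :
  (forall a k, F << a *g k >> = H << a *g k >>) -> F =1 H.
Proof.
by move=> FH q; rewrite (monalgE q) !raddf_sum; apply: eq_bigr => k _; apply: FH.
Qed.

Lemma tv_ord0 n : tv (ord0 : 'I_n.+1) = 0.
Proof. by rewrite /tv unlift_none. Qed.

Lemma tv_lift n (k : 'I_n) : tv (lift ord0 k) = << fmu k >>.
Proof. by rewrite /tv liftK. Qed.

HB.lock Definition word n (s : seq 'I_n) : TV n := << FMonom s >>.

Lemma wordE n (s : seq 'I_n) : word s = << FMonom s >>.
Proof. by rewrite word.unlock. Qed.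

Lemma word0 n : word [::] = 1 :> TV n.
Proof. by rewrite word.unlock -fmoneE. Qed.

Lemma wordM n (s t : seq 'I_n) : word s * word t = word (s ++ t).
Proof.
rewrite word.unlock malgM_def fgmulUU mul1r; congr << _ *g _ >>.
by apply/eqP; rewrite fmP fmM.
Qed.

Lemma word_cons n k (s : seq 'I_n) : word (k :: s) = tv (lift ord0 k) * word s.
Proof. by rewrite tv_lift fmuE -wordE wordM. Qed.

Lemma word_prod n (s : seq 'I_n) : \prod_(k <- s) tv (lift ord0 k) = word s.
Proof.
by elim: s => [|k s IH]; rewrite ?big_nil ?word0 // big_cons word_cons IH.
Qed.

Lemma monalgU_word n a (s : seq 'I_n) : << a *g FMonom s >> = word s *~ a :> TV n.
Proof.
rewrite wordE -[in LHS](intz a).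
exact: (raddfMz (mkmalgU (FMonom s)) a (1 : int)).
Qed.

Lemma TV_ext n (M : zmodType) (F H : {additive TV n -> M}) :
  (forall s, F (word s) = H (word s)) -> F =1 H.
Proof.
move=> FH; apply: malg_additive_ext => a [s].
by rewrite monalgU_word !raddfMz FH.
Qed.

Lemma TV_closed n (M : zmodType) (F : {additive TV n -> M}) (D : zmodClosed M) :
  (forall s, F (word s) \in D) -> forall x, F x \in D.
Proof.
move=> h x; rewrite (monalgE x) raddf_sum; apply: rpred_sum => -[s] _.
by rewrite /= monalgU_word raddfMz rpredMz.
Qed.

Section TvMap.
Variables (n m : nat) (a : fin_hom n m).
Let h (w : {fmonom 'I_n}) : TV m :=
  \prod_(k <- w) (tv (a (lift ord0 k)) - tv (a ord0)).

Fact tv_map_mmorph : mmorphism h.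
Proof. by split; [move=> [s] [t]; rewrite /h fmM big_cat | rewrite /h fm1 big_nil]. Qed.

Fact tv_map_additive : zmod_morphism (tv_map a).
Proof. move=> x y; exact: (raddfB (mmap _ _)). Qed.

Fact tv_map_multiplicative : monoid_morphism (tv_map a).
Proof.
pose hm : {mmorphism {fmonom 'I_n} -> TV m} :=
  HB.pack h (isMultiplicative.Build _ _ h tv_map_mmorph).
rewrite /tv_map.
have := @commr_mmap_is_multiplicative _ _ _ intr hm.
case=> [g w w'|h1 h2]; first exact/commr_sym/commr_int.
by split.
Qed.

HB.instance Definition _ := GRing.isZmodMorphism.Build _ _ (tv_map a) tv_map_additive.
HB.instance Definition _ := GRing.isMonoidMorphism.Build _ _ (tv_map a) tv_map_multiplicative.

Lemma tv_mapE s : tv_map a (word s) =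
  \prod_(k <- s) (tv (a (lift ord0 k)) - tv (a ord0)).
Proof. by rewrite wordE /tv_map mmapU mul1r. Qed.

Lemma tv_map_tv i : tv_map a (tv i) = tv (a i) - tv (a ord0).
Proof.
case: (unliftP ord0 i) => [k|] ->; last by rewrite tv_ord0 raddf0 subrr.
by rewrite tv_lift fmuE -wordE tv_mapE big_seq1.
Qed.
End TvMap.

Lemma tv_map_id n x : tv_map (fin_id n) x = x.
Proof.
apply: (@TV_ext _ _ (tv_map (fin_id n)) idfun) => s.
rewrite /= tv_mapE -word_prod; apply: eq_bigr => k _.
by rewrite !ffunE tv_ord0 subr0.
Qed.

Lemma tv_map_comp n m p (b : fin_hom m p) (a : fin_hom n m) x :
  tv_map (fin_comp b a) x = tv_map b (tv_map a x).
Proof.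
apply: (@TV_ext _ _ (tv_map (fin_comp b a)) (tv_map b \o tv_map a)) => s.
rewrite /= !tv_mapE rmorph_prod; apply: eq_bigr => k _.
by rewrite raddfB /= !tv_map_tv !ffunE opprB addrA subrK.
Qed.

Definition TVfin : finAb :=
  @FinAb (fun n => TV n) (fun n m a => tv_map a) tv_map_id tv_map_comp.

(* Out of range indices are sent to [ord0] by [inord], hence to [0] by [tv]. *)
Definition vn n (k : nat) : TV n := tv (inord k).

Lemma vn0 n : vn n 0 = 0.
Proof. by rewrite -(tv_ord0 n); congr tv; apply: val_inj; rewrite /= inordK. Qed.

Lemma vn_out n k : (n < k)%N -> vn n k = 0.
Proof.
move=> h; rewrite -(tv_ord0 n); congr tv.
by rewrite /inord /insubd insubN // -leqNgt.
Qed.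

Lemma vn_lift n (k : 'I_n) : tv (lift ord0 k) = vn n k.+1.
Proof. by congr tv; apply: val_inj; rewrite /= inordK // ltnS. Qed.

Definition mapn n m (a : nat -> nat) : {rmorphism TV n -> TV m} :=
  tv_map [ffun i : 'I_n.+1 => inord (a i) : 'I_m.+1].

Lemma mapnE n m a x :
  mapn n m a x = tv_map [ffun i : 'I_n.+1 => inord (a i) : 'I_m.+1] x.
Proof. by []. Qed.

Lemma mapn_vn n m a k : (k <= n)%N -> a 0 = 0%N ->
  mapn n m a (vn n k) = vn m (a k).
Proof.
move=> kn a0; rewrite mapnE /vn tv_map_tv !ffunE inordK // a0.
by rewrite -/(vn m 0) vn0 subr0.
Qed.

Lemma mapn_eq n m a b x : (forall k, (k <= n)%N -> a k = b k) ->
  mapn n m a x = mapn n m b x.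
Proof.
move=> ab; rewrite !mapnE; congr (tv_map _ x); apply/ffunP=> i; rewrite !ffunE ab //.
by rewrite -ltnS.
Qed.

Lemma mapn_comp n m p b a x : (forall k, (k <= n)%N -> (a k <= m)%N) ->
  mapn m p b (mapn n m a x) = mapn n p (b \o a) x.
Proof.
move=> am; rewrite !mapnE -tv_map_comp; congr (tv_map _ x); apply/ffunP=> i.
by rewrite !ffunE inordK // ltnS am // -ltnS.
Qed.

Lemma mapn_id n a x : (forall k, (k <= n)%N -> a k = k) -> mapn n n a x = x.
Proof.
move=> h; rewrite mapnE -[RHS]tv_map_id; congr (tv_map _ x); apply/ffunP=> i.
by rewrite !ffunE h ?inord_val // -ltnS.
Qed.

Lemma tv_map_codegen n (i : 'I_n.+2) x : tv_map (codegen i) x = mapn n.+1 n (mu n i) x.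
Proof. by rewrite mapnE; congr (tv_map _ x). Qed.

HB.lock Definition lext n m (F : seq 'I_n -> TV m) : {additive TV n -> TV m} :=
  mmap intr (fun w : {fmonom 'I_n} => F w).

Lemma lextE n m (F : seq 'I_n -> TV m) s : lext F (word s) = F s.
Proof. by rewrite wordE lext.unlock /= mmapU mul1r. Qed.

Definition face_sumT n : TV n.+1 -> TV n := @face_sum TV mapn n.
Definition pshuffleT n : nat -> TV n -> TV n.+1 := @pshuffle TV vn mapn n.
Definition shuffleT n : TV n -> TV n.+1 := @shuffle TV vn mapn n.

HB.instance Definition _ n := GRing.Additive.copy (@face_sumT n) (@face_sum TV mapn n).
HB.instance Definition _ n k := GRing.Additive.copy (@pshuffleT n k) (@pshuffle TV vn mapn n k).
HB.instance Definition _ n := GRing.Additive.copy (@shuffleT n) (@shuffle TV vn mapn n).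

(** The letter [k : 'I_n] stands for [v_(k+1)]; hence [k.+1] here, and the test [k == n] for the top
    letter in [unshuffleT]. *)
Definition contractT n : {additive TV n -> TV n.+1} :=
  lext (fun s => if s is k :: t then pshuffleT k.+1 (word t) else 0).

Definition emptyT n : {additive TV n -> TV n} :=
  lext (fun s : seq 'I_n => if s is _ :: _ then 0 else 1).

Definition unshuffleT n : {additive TV n.+1 -> TV n} :=
  lext (fun s : seq 'I_n.+1 => if s is k :: t then
    if k == n :> nat then mapn n.+1 n (mu n n.+1) (word t) *~ (-1) ^+ n else 0
    else 0).

Lemma TV_ext_cons n (M : zmodType) (F H : {additive TV n -> M}) : F 1 = H 1 ->
  (forall k y, (0 < k <= n)%N -> F (vn n k * y) = H (vn n k * y)) -> F =1 H.
Proof.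
move=> e1 e; apply: TV_ext => -[|k t]; first by rewrite word0.
by rewrite word_cons vn_lift e //=.
Qed.

(** Turns a definition by first letter on words into a rule for [v_k y] with arbitrary [y], the form
    required by the abstract homotopy. *)
Lemma lext_cons n m (F : seq 'I_n -> TV m) (k : nat) (G : {additive TV n -> TV m}) :
  (forall (i : 'I_n) t, i.+1 = k -> F (i :: t) = G (word t)) ->
  forall y, (0 < k <= n)%N -> lext F (vn n k * y) = G y.
Proof.
move=> FG y; case: k FG => // k FG hk.
have /(_ y) /= -> // : lext F \o (vn n k.+1 \*o idfun) =1 G.
by apply: TV_ext => s /=; rewrite -(vn_lift (Ordinal hk)) -word_cons lextE FG.
Qed.

Lemma contractT_vn n k y : (0 < k <= n)%N -> contractT n (vn n k * y) = pshuffleT k y.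
Proof. by apply: (lext_cons (G := @pshuffleT n k)) => i t <-. Qed.

Lemma emptyT_vn n k y : (0 < k <= n)%N -> emptyT n (vn n k * y) = 0.
Proof. by apply: (lext_cons (G := \0)). Qed.

Lemma unshuffleT_vn n k y : (0 < k <= n.+1)%N -> unshuffleT n (vn n.+1 k * y) =
  if k == n.+1 then mapn n.+1 n (mu n n.+1) y *~ (-1) ^+ n else 0.
Proof.
move=> hk; case: eqP => [->|/eqP kn].
  pose G := ((-1) ^+ n \*o mapn n.+1 n (mu n n.+1)) : {additive TV n.+1 -> TV n}.
  transitivity (G y); last by rewrite /G /= -mulrzl rmorphXn /= rmorphN1.
  apply: lext_cons; last lia.
  by move=> i t [->]; rewrite eqxx /G /= -mulrzl rmorphXn /= rmorphN1.
apply: (lext_cons (G := \0)) => // i t ik; case: eqP => // e.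
by move: kn; rewrite -ik e eqxx.
Qed.

Lemma contractT1 n : contractT n 1 = 0. Proof. by rewrite -[X in contractT n X]word0 lextE. Qed.
Lemma emptyT1 n : emptyT n 1 = 1. Proof. by rewrite -[X in emptyT n X]word0 lextE. Qed.
Lemma unshuffleT1 n : unshuffleT n 1 = 0. Proof. by rewrite -[X in unshuffleT n X]word0 lextE. Qed.

Lemma homotopyT n x : face_sumT (contractT n.+1 x) + contractT n (face_sumT x) =
  x - emptyT n.+1 x - shuffleT (unshuffleT n x).
Proof.
exact: (homotopy vn0 vn_out mapn_vn mapn_eq mapn_comp mapn_id TV_ext_cons
  contractT1 contractT_vn emptyT1 emptyT_vn unshuffleT1 unshuffleT_vn).
Qed.

Lemma unshuffle_shuffleT n y : unshuffleT n (shuffleT y) = y.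
Proof. exact: (pi_shuffle mapn_comp mapn_id unshuffleT_vn). Qed.

Lemma unshuffle_faceT n x : unshuffleT n (face_sumT x) = - face_sumT (unshuffleT n.+1 x).
Proof.
exact: (pi_face vn0 mapn_vn mapn_eq mapn_comp TV_ext_cons unshuffleT1 unshuffleT_vn).
Qed.

Lemma face_sumT_shuffleT n (y : TV n.+1) :
  face_sumT (shuffleT y) = - shuffleT (face_sumT y).
Proof. exact: (face_shuffle vn0 vn_out mapn_vn mapn_eq mapn_comp mapn_id). Qed.

Lemma face_sumT0 (x : TV 1) : face_sumT x = 0.
Proof. exact: (face_sum0 mapn_eq). Qed.

Lemma signz_swap (A : pzRingType) (x y : A) (q : nat) (b : bool) :
  (-1) ^+ q * (-1) ^+ b * (x * y) = (x * ((-1) ^+ b * y)) *~ (-1) ^+ q.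
Proof.
rewrite -[RHS]mulrzl rmorphXn rmorphN1 -mulrA; congr (_ * _).
by rewrite [RHS]mulrA commr_sign -mulrA.
Qed.

Lemma lift_perm0_bij n :
  bijective (fun p : 'I_n.+1 * 'S_n => lift_perm ord0 p.1 p.2).
Proof.
apply: inj_card_bij => [[i s] [j t] /= e|]; last first.
  by rewrite card_prod card_ord !card_Sn factS.
have ij : i = j.
  by have := congr1 (fun u : 'S_n.+1 => u ord0) e; rewrite /= !lift_perm_id.
rewrite {}ij in e *; congr (_, _); apply/permP => k.
have := congr1 (fun u : 'S_n.+1 => u (lift ord0 k)) e.
by rewrite /= !lift_perm_lift => /lift_inj.
Qed.

Lemma shuffleTE n (y : TV n) : shuffleT y =
  \sum_(q < n.+1) (vn n.+1 q.+1 * mapn n n.+1 (bump q.+1) y) *~ (-1) ^+ q.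
Proof. by rewrite [LHS]shuffleE big_mkord. Qed.

Lemma antisym0 : antisym 0 = 1.
Proof.
rewrite /antisym (big_pred1 1%g) => [|s]; first by rewrite odd_perm1 big_ord0 mulr1.
by apply/esym/eqP/permP => -[].
Qed.

(** Sort the permutations by their first value [q]. What remains is a permutation of the other
    letters, relabelled by the coface that misses [q.+1], and the sign splits as [(-1)^q] times the
    smaller sign. *)
Lemma antisymS n : antisym n.+1 = shuffleT (antisym n).
Proof.
rewrite shuffleTE /antisym (reindex _ (onW_bij _ (lift_perm0_bij n))) /=.
rewrite -(pair_bigA _ (fun q s => (-1) ^+ lift_perm ord0 q s *
  \prod_(i < n.+1) tv (lift ord0 (lift_perm ord0 q s i)))) /=.
apply: eq_bigr => q _; rewrite raddf_sum mulr_sumr mulrz_suml.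
apply: eq_bigr => s _.
rewrite big_ord_recl lift_perm_id odd_lift_perm /= vn_lift.
rewrite signr_addb signr_odd rmorphM rmorph_sign /= rmorph_prod.
under [in LHS]eq_bigr => i _ do rewrite lift_perm_lift vn_lift /= /bump /=.
under [in RHS]eq_bigr => i _ do rewrite vn_lift /= mapn_vn // /bump ltnS addnS.
exact: signz_swap.
Qed.

(** * Coefficients in a DG-ring *)

Section LinearExtension.
Variables (K : choiceType) (G M : zmodType) (F : K -> {additive G -> M}).

Definition mlin (q : {malg G[K]}) : M := \sum_(k <- msupp q) F k q@_k.

Lemma mlinEw (d : {fset K}) q : (msupp q `<=` d)%fset ->
  mlin q = \sum_(k <- d) F k q@_k.
Proof.
move=> le; rewrite /mlin (big_fset_incl _ le) // => k _ /mcoeff_outdom ->.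
exact: raddf0.
Qed.

Fact mlin_additive : zmod_morphism mlin.
Proof.
move=> p q; rewrite (mlinEw (msuppB_le p q)).
rewrite (mlinEw (fsubsetUl (msupp p) (msupp q))).
rewrite (mlinEw (fsubsetUr (msupp p) (msupp q))) -sumrB.
by apply: eq_bigr => k _; rewrite mcoeffB raddfB.
Qed.
HB.instance Definition _ := GRing.isZmodMorphism.Build _ _ mlin mlin_additive.

Lemma mlinU a k : mlin << a *g k >> = F k a.
Proof.
rewrite (mlinEw msuppU_le) big_seq_fset1 mcoeffUU //.
Qed.
End LinearExtension.

Section CoefIn.
Variables (K : choiceType) (G : zmodType) (D : K -> zmodClosed G).

Definition coefin : {pred {malg G[K]}} := fun q => `[< forall k, q@_k \in D k >].

Lemma coefinP q : reflect (forall k, q@_k \in D k) (q \in coefin).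
Proof. exact: asboolP. Qed.

Fact coefin_closed : zmod_closed coefin.
Proof.
split; first by apply/coefinP => k; rewrite mcoeff0 rpred0.
by move=> p q /coefinP hp /coefinP hq; apply/coefinP => k; rewrite mcoeffB rpredB.
Qed.
HB.instance Definition _ := GRing.isZmodClosed.Build _ coefin coefin_closed.

Lemma coefinU a k : a \in D k -> << a *g k >> \in coefin.
Proof.
move=> ha; apply/coefinP => l; rewrite mcoeffU; case: eqP => [<-|_] //=.
exact: rpred0.
Qed.
End CoefIn.

(** Either all of [G] or zero. It makes a support condition a special case of [coefin], so that
    grading and degeneracy are transported by the same lemma [amap_coefin]. *)
Definition zero_unless (G : zmodType) (b : bool) : {pred G} := fun x => b || (x == 0).

Fact zero_unless_closed (G : zmodType) b : zmod_closed (@zero_unless G b).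
Proof.
split; first by rewrite -topredE /= /zero_unless eqxx orbT.
move=> x y; rewrite -!topredE /= /zero_unless; case: b => //= /eqP-> /eqP->.
by rewrite subr0.
Qed.
HB.instance Definition _ (G : zmodType) b :=
  GRing.isZmodClosed.Build G (@zero_unless G b) (zero_unless_closed G b).

(* Locked, since comparing two values of [tens] by conversion would unfold the
   finitely supported families. *)
HB.lock Definition tensor (A : dgRing) n (a : A) (x : TV n) : ATV A n := tens a x.

Section Tensor.
Variable A : dgRing.

Lemma tens_tensor n (a : A) (x : TV n) : tens a x = tensor a x.
Proof. by rewrite tensor.unlock. Qed.

Lemma tensorE n (a : A) (x : TV n) w : (tensor a x)@_w = a *~ x@_w.
Proof.
rewrite tensor.unlock /tens raddf_sum /=; have [hw|hw] := boolP (w \in msupp x).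
  rewrite (big_fsetD1 w) //= mcoeffUU big1_seq ?addr0 // => k /andP[_].
  by rewrite in_fsetD1 mcoeffU => /andP[/negbTE-> _].
rewrite (mcoeff_outdom hw) mulr0z big1_seq //= => k hk; rewrite mcoeffU.
by case: eqP hk hw => // -> ->.
Qed.

Fact tens_additivel n (x : TV n) : zmod_morphism (fun a : A => tensor a x).
Proof. by move=> a b /=; apply/malgP => w; rewrite [RHS]mcoeffB !tensorE mulrzBl. Qed.

Fact tens_additiver n (a : A) : zmod_morphism (@tensor A n a).
Proof.
move=> x y /=; apply/malgP => w; rewrite [RHS]mcoeffB !tensorE.
by rewrite (mcoeffB w x y) mulrzBr.
Qed.

HB.instance Definition _ n a := GRing.isZmodMorphism.Build _ _ (@tensor A n a) (@tens_additiver n a).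

Definition tensl n (x : TV n) : {additive A -> ATV A n} :=
  HB.pack (fun a : A => tensor a x)
    (GRing.isZmodMorphism.Build _ _ (fun a : A => tensor a x) (tens_additivel x)).

Lemma tens0l n (x : TV n) : tensor (0 : A) x = 0.
Proof. exact: (raddf0 (tensl x)). Qed.

Lemma tensDl n (x : TV n) (a b : A) : tensor (a + b) x = tensor a x + tensor b x.
Proof. exact: (raddfD (tensl x)). Qed.

Lemma tensBl n (x : TV n) (a b : A) : tensor (a - b) x = tensor a x - tensor b x.
Proof. exact: (raddfB (tensl x)). Qed.

Lemma tens_word n (a : A) s : tensor a (word s) = << a *g FMonom s >> :> ATV A n.
Proof.
apply/malgP => w; rewrite tensorE wordE !mcoeffU; case: eqP => _; last exact: mulr0z.
by rewrite mulr1z.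
Qed.

Lemma tens_coefin n (D : {fmonom 'I_n} -> zmodClosed A) a x :
  (forall w, x@_w != 0 -> a \in D w) -> tensor a x \in coefin D.
Proof.
move=> h; apply/coefinP => w; rewrite tensorE.
have [->|hx] := eqVneq (x@_w) 0; first by rewrite mulr0z rpred0.
by rewrite rpredMz // h.
Qed.

Lemma ATV_ext n (M : zmodType) (F H : {additive ATV A n -> M}) :
  (forall a s, F (tensor a (word s)) = H (tensor a (word s))) -> F =1 H.
Proof.
by move=> FH; apply: malg_additive_ext => a [s]; rewrite -tens_word.
Qed.

End Tensor.

HB.lock Definition amap (A : dgRing) n m (G : TV n -> TV m) :
    {additive ATV A n -> ATV A m} :=
  mlin (fun w : {fmonom 'I_n} => tensl A (G << w >>)).

Section Amap.
Variable A : dgRing.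
Local Notation amap := (@amap A _ _).

Lemma amap_word n m (G : TV n -> TV m) a s :
  amap G (tensor a (word s)) = tensor a (G (word s)).
Proof. by rewrite tens_word amap.unlock /= mlinU /= -wordE. Qed.

Lemma amap_tens n m (G : {additive TV n -> TV m}) a x :
  amap G (tensor a x) = tensor a (G x).
Proof.
have /(_ x) /= -> // : amap G \o tensor a =1 tensor a \o G.
by apply: TV_ext => s /=; rewrite amap_word.
Qed.

Lemma amap_coefin n m (G : TV n -> TV m) (D : {fmonom 'I_n} -> zmodClosed A)
    (D' : {fmonom 'I_m} -> zmodClosed A) q :
  (forall s w, (G (word s))@_w != 0 -> {subset D (FMonom s) <= D' w}) ->
  q \in coefin D -> amap G q \in coefin D'.
Proof.
move=> GD /coefinP hq; rewrite amap.unlock /= /mlin; apply: rpred_sum => -[s] _.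
rewrite /= -wordE; apply: tens_coefin => w hw; exact: (GD s).
Qed.

End Amap.

(** * Word length and number of distinct letters under the operators *)

Section Words.
Variables (n : nat) (P : pred (seq 'I_n)).

Definition words : {pred TV n} :=
  coefin (fun w : {fmonom 'I_n} => @zero_unless int (P w)).

HB.instance Definition _ := GRing.ZmodClosed.on words.

Lemma wordsP x : reflect (forall w : {fmonom 'I_n}, x@_w != 0 -> P w) (x \in words).
Proof.
apply: (iffP (coefinP _ _)) => h w.
  by move/negPf=> e; have := h w; rewrite -topredE /= /zero_unless e orbF.
rewrite -topredE /= /zero_unless; case: eqP => [|/eqP/h ->] //.
by rewrite orbT.
Qed.

Lemma word_words s : P s -> word s \in words.
Proof.
move=> hs; apply/wordsP => w; rewrite wordE mcoeffU1 => h.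
by move: h; case: (FMonom s =P w) => [<-|].
Qed.
End Words.

Lemma tv_map_pointed n m (a : fin_hom n m) (f : 'I_n -> 'I_m) s :
  a ord0 = ord0 -> (forall k, a (lift ord0 k) = lift ord0 (f k)) ->
  tv_map a (word s) = word (map f s).
Proof.
move=> a0 af; rewrite tv_mapE -word_prod big_map; apply: eq_bigr => k _.
by rewrite a0 af tv_ord0 subr0.
Qed.

Lemma mapn_bump n (q : 'I_n.+1) s :
  mapn n n.+1 (bump q.+1) (word s) = word (map (lift q) s).
Proof.
rewrite mapnE; apply: tv_map_pointed => [|k]; rewrite ffunE; apply: val_inj.
  by rewrite /= inordK.
have := ltn_ord k => hk; rewrite /= inordK /bump /= !add1n ltnS ?addnS //.
by move: hk => /=; case: (q < k.+1)%N => /=; lia.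
Qed.

(** The letter put in front is the one that the coface misses, hence a new one. The bound on [k]
    ensures that it is a genuine letter. *)
Lemma pshuffleT_word n k s : (k <= n.+1)%N -> pshuffleT k (word s) \in
  words (fun w : seq 'I_n.+1 => (size w == (size s).+1) &&
    (size (undup w) == (size (undup s)).+1)).
Proof.
move=> hk; rewrite rpredN big_nat_cond rpred_sum // => q /andP[/andP[_ hq] _].
have hq' : (q < n.+1)%N by lia.
apply: rpredMz; rewrite -(vn_lift (Ordinal hq')) (mapn_bump (Ordinal hq')).
rewrite -word_cons; apply: word_words; rewrite /= size_map eqxx /=.
rewrite ifN; last by apply/mapP => -[l _ /eqP]; rewrite (negPf (neq_lift _ _)).
by rewrite /= (undup_map_inj lift_inj) size_map.
Qed.

(** A letter is removed before one is added, which keeps the length. At most one distinct letter is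
    gained, matching the gain in dimension, so degeneracy will be preserved. *)
Lemma contractT_word n s : contractT n (word s) \in
  words (fun w : seq 'I_n.+1 => (size w == size s) &&
    (size (undup w) <= (size (undup s)).+1)%N).
Proof.
rewrite lextE; case: s => [|k t]; first exact: rpred0.
have /wordsP h := @pshuffleT_word n k.+1 t (leqW (ltn_ord k)).
apply/wordsP => w /h /andP[/eqP-> /eqP->]; rewrite /= eqxx /=.
by case: ifP.
Qed.

Lemma shuffleT_word n s : shuffleT (word s) \in
  words (fun w : seq 'I_n.+1 => (size w == (size s).+1) &&
    (size (undup w) == (size (undup s)).+1)).
Proof. by rewrite rpredN pshuffleT_word. Qed.

Lemma map_lift_ex n (i : 'I_n.+1) s : i \notin s ->
  exists t : seq 'I_n, s = map (lift i) t.
Proof.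
elim: s => [|k s IH]; first by exists [::].
rewrite inE negb_or => /andP[ik /IH[t ->]].
by have [k' -> _] := unlift_some ik; exists (k' :: t).
Qed.

(** If the top letter recurs in the tail, the last face sends it to [v_0 = 0] and the result
    vanishes. Otherwise the tail avoids it, and exactly one letter is lost, in length and in
    distinct letters. *)
Lemma unshuffleT_word n (s : seq 'I_n.+1) : unshuffleT n (word s) \in
  words (fun w : seq 'I_n => (size s == (size w).+1) &&
    (size (undup s) == (size (undup w)).+1)).
Proof.
rewrite lextE; case: s => [|k t]; first exact: rpred0.
case: eqP => [kn|_]; last exact: rpred0.
have -> : k = ord_max by apply: val_inj.
apply: rpredMz; have [ht|ht] := boolP (ord_max \in t).
  have -> : mapn n.+1 n (mu n n.+1) (word t) = 0; last exact: rpred0.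
  case/splitPr: ht => t1 t2; rewrite -word_prod big_cat big_cons /= rmorphM rmorphM.
  rewrite /= vn_lift mapn_vn; [|by []|by rewrite /mu; case: ifP].
  have -> : mu n n.+1 (@ord_max n).+1 = 0%N by rewrite /mu /= !eqxx.
  by rewrite vn0 mul0r mulr0.
have [t' e] := map_lift_ex ht.
have -> : mapn n.+1 n (mu n n.+1) (word t) = word t'.
  rewrite e -mapn_bump mapn_comp => [|l hl]; last by rewrite /bump; lia.
  by apply: mapn_id => l hl; rewrite /= /bump /mu; repeat case: ifP; lia.
apply: word_words; rewrite /= (negPf ht) e /= size_map eqxx.
by rewrite (undup_map_inj lift_inj) size_map eqxx.
Qed.

Lemma emptyT_word n s : emptyT n (word s) \in words (fun w : seq 'I_n => size (undup w) == 0).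
Proof.
rewrite lextE; case: s => [|k t]; last exact: rpred0.
by rewrite -word0 word_words.
Qed.

Lemma missing_letter n (s : seq 'I_n) : (size (undup s) < n)%N ->
  exists i, i \notin s.
Proof.
move=> h; apply/existsP; apply: contraLR h; rewrite negb_exists -leqNgt.
move/forallP=> h; rewrite -[leqLHS]card_ord -(card_uniqP (undup_uniq s)).
by apply: subset_leq_card; apply/subsetP => i _; rewrite mem_undup -[_ \in _]negbK.
Qed.

Lemma degenerate_words n x : x \in @degenerate TVfin n ->
  x \in words (fun w : seq 'I_n => size (undup w) < n)%N.
Proof.
case: n x => [|n] x; first by move=> /eqP ->; exact: rpred0.
move=> /asboolP[y ->]; apply: rpred_sum => i _ /=.
pose D := words (fun w : seq 'I_n.+1 => size (undup w) < n.+1)%N.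
apply: (TV_closed (D := D)) => s.
rewrite /= (tv_map_pointed (f := lift i)) => [||k].
- apply: word_words; rewrite (undup_map_inj lift_inj) size_map ltnS.
  rewrite -[leqRHS]card_ord -(card_uniqP (undup_uniq s)).
  exact: max_card.
- by rewrite ffunE; apply: val_inj.
- by rewrite !ffunE; apply: val_inj; rewrite /= /bump; lia.
Qed.

Lemma chain_b_TV n x : chain_b TVfin n x = face_sumT x.
Proof.
rewrite [RHS]/face_sumT /face_sum big_mkord.
by apply: eq_bigr => i _; rewrite [LHS]/= tv_map_codegen.
Qed.

(** A word missing a letter is in the image of a coface, so the stability of degenerate elements in
    any Fin-abelian group applies to [TVfin]. This avoids examining single faces, which may well
    fail to preserve the condition letter by letter. *)
Lemma face_sumT_degen n s : (size (undup s) < n.+1)%N ->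
  face_sumT (word s) \in words (fun w : seq 'I_n => size (undup w) < n)%N.
Proof.
move=> hs; have [i /map_lift_ex[t e]] := missing_letter hs.
rewrite -chain_b_TV; apply/degenerate_words/chain_b_degenerate.
have -> : word s = fa_map TVfin (coface (lift ord0 i)) (word t).
  rewrite e /=; apply/esym/tv_map_pointed => [|k]; rewrite !ffunE; apply: val_inj => //.
  by rewrite /= /bump; lia.
apply: (@degenerate_miss TVfin _ _ _ (lift ord0 i)) => // k.
by rewrite ffunE eq_sym neq_lift.
Qed.

(** * Cycles and boundaries modulo degenerate elements *)

Section NormalizedTensor.
Variable A : dgRing.

Definition degen n : {pred ATV A n} :=
  coefin (fun w : {fmonom 'I_n} => @zero_unless A (size (undup w) < n)%N).

HB.instance Definition _ n := GRing.ZmodClosed.on (@degen n).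

(** The family [D] is a parameter for three uses: [dg_deg A] gives [Q^n A], [D \o succn] describes
    the coefficients after an unshuffle, and [zero_unless] gives a bound on word length. *)
Definition graded (D : nat -> zmodClosed A) n : {pred ATV A n} :=
  coefin (fun w : {fmonom 'I_n} => D (size w)).

HB.instance Definition _ D n := GRing.ZmodClosed.on (@graded D n).

Definition faceA n : {additive ATV A n.+1 -> ATV A n} := amap A (@face_sumT n).
Definition contractA n : {additive ATV A n -> ATV A n.+1} := amap A (contractT n).
Definition emptyA n : {additive ATV A n -> ATV A n} := amap A (emptyT n).
Definition unshuffleA n : {additive ATV A n.+1 -> ATV A n} := amap A (unshuffleT n).
Definition shuffleA n : {additive ATV A n -> ATV A n.+1} := amap A (@shuffleT n).

Lemma zero_unlessS (b c : bool) : (b -> c) ->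
  {subset @zero_unless A b <= @zero_unless A c}.
Proof.
move=> bc x; rewrite -!topredE /= /zero_unless => /orP[/bc->|->] //.
by rewrite orbT.
Qed.

Lemma zero_unlessT (b : bool) x : b -> x \in @zero_unless A b.
Proof. by rewrite -topredE /= /zero_unless => ->. Qed.

Lemma faceA_degen n q : q \in @degen n.+1 -> faceA n q \in @degen n.
Proof.
apply: amap_coefin => s w hw; apply: zero_unlessS => /face_sumT_degen/wordsP.
exact.
Qed.

Lemma contractA_degen n q : q \in @degen n -> contractA n q \in @degen n.+1.
Proof.
apply: amap_coefin => s w hw; apply: zero_unlessS => hs.
have /wordsP/(_ _ hw)/andP[_ h] := contractT_word s.
exact: leq_ltn_trans h _.
Qed.

Lemma unshuffleA_degen n q : q \in @degen n.+1 -> unshuffleA n q \in @degen n.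
Proof.
apply: amap_coefin => s w hw; apply: zero_unlessS.
by have /wordsP/(_ _ hw)/andP[_ /eqP->] := unshuffleT_word s.
Qed.

Lemma shuffleA_degen n q : q \in @degen n -> shuffleA n q \in @degen n.+1.
Proof.
apply: amap_coefin => s w hw; apply: zero_unlessS => hs.
by have /wordsP/(_ _ hw)/andP[_ /eqP->] := shuffleT_word s.
Qed.

Lemma emptyA_degen n (q : ATV A n.+1) : emptyA _ q \in @degen n.+1.
Proof.
have : q \in coefin (fun w : {fmonom 'I_n.+1} => @zero_unless A true) by apply/coefinP.
apply: amap_coefin => s w hw; apply: zero_unlessS => _.
by have /wordsP/(_ _ hw)/eqP-> := emptyT_word s.
Qed.

Lemma short_degen n m (q : ATV A n) : (m < n)%N ->
  q \in coefin (fun w : {fmonom 'I_n} => @zero_unless A (size w <= m)%N) ->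
  q \in @degen n.
Proof.
move=> mn /coefinP h; apply/coefinP => w; apply: zero_unlessS (h w) => hw.
exact: leq_ltn_trans (size_undup _) (leq_ltn_trans hw mn).
Qed.

Lemma contractA_graded D n q : q \in @graded D n -> contractA n q \in @graded D n.+1.
Proof.
apply: amap_coefin => s w hw.
by have /wordsP/(_ _ hw)/andP[/eqP-> _] := contractT_word s.
Qed.

Lemma unshuffleA_graded D n q : q \in @graded D n.+1 -> unshuffleA n q \in @graded (D \o succn) n.
Proof.
apply: amap_coefin => s w hw /=.
by have /wordsP/(_ _ hw)/andP[/eqP<- _] := unshuffleT_word s.
Qed.

Lemma shuffleA_graded D n q : q \in @graded (D \o succn) n -> shuffleA n q \in @graded D n.+1.
Proof.
apply: amap_coefin => s w hw /=.
by have /wordsP/(_ _ hw)/andP[/eqP-> _] := shuffleT_word s.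
Qed.

Lemma homotopyA n q :
  faceA _ (contractA n.+1 q) + contractA n (faceA n q) = q - emptyA _ q - shuffleA n (unshuffleA n q).
Proof.
pose F : {additive ATV A n.+1 -> ATV A n.+1} :=
  (faceA n.+1 \o contractA n.+1) \+ (contractA n \o faceA n).
pose H : {additive ATV A n.+1 -> ATV A n.+1} :=
  (idfun \- emptyA n.+1) \- (shuffleA n \o unshuffleA n).
have /(_ q) // : F =1 H; apply: ATV_ext => a s; rewrite /F /H /=.
rewrite !amap_word !amap_tens -!raddfB -raddfD /=; congr (tensor _ _).
exact: homotopyT.
Qed.

Lemma unshuffleA_faceA n q : unshuffleA n (faceA n.+1 q) = - faceA n (unshuffleA n.+1 q).
Proof.
pose F : {additive ATV A n.+2 -> ATV A n} := unshuffleA n \o faceA n.+1.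
pose H : {additive ATV A n.+2 -> ATV A n} := \- (faceA n \o unshuffleA n.+1).
have /(_ q) // : F =1 H; apply: ATV_ext => a s; rewrite /F /H /=.
by rewrite !amap_word !amap_tens -raddfN unshuffle_faceT.
Qed.

Lemma faceA_shuffleA n q : faceA n.+1 (shuffleA n.+1 q) = - shuffleA n (faceA n q).
Proof.
pose F : {additive ATV A n.+1 -> ATV A n.+1} := faceA n.+1 \o shuffleA n.+1.
pose H : {additive ATV A n.+1 -> ATV A n.+1} := \- (shuffleA n \o faceA n).
have /(_ q) // : F =1 H; apply: ATV_ext => a s; rewrite /F /H /=.
by rewrite !amap_word !amap_tens /= face_sumT_shuffleT raddfN.
Qed.

Lemma shuffleA_antisym n a : shuffleA n (tensor a (antisym n)) = tensor a (antisym n.+1).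
Proof. by rewrite amap_tens antisymS. Qed.

Lemma unshuffleA_antisym n a : unshuffleA n (tensor a (antisym n.+1)) = tensor a (antisym n).
Proof. by rewrite amap_tens antisymS unshuffle_shuffleT. Qed.

Lemma faceA0 (q : ATV A 1) : faceA 0 q = 0.
Proof.
have /(_ q) // : faceA 0 =1 \0; apply: ATV_ext => a s.
by rewrite amap_word face_sumT0 raddf0.
Qed.

Lemma faceA_antisym n a : faceA n (tensor a (antisym n.+1)) = 0.
Proof.
elim: n => [|n IH]; first exact: faceA0.
by rewrite -shuffleA_antisym faceA_shuffleA IH raddf0 oppr0.
Qed.

Lemma ATV0E (q : ATV A 0) : q = tensor q@_(FMonom [::]) (antisym 0).
Proof.
apply/malgP => -[[|[]//]]; rewrite tensorE antisym0 -word0 wordE mcoeffUU.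
by rewrite mulr1z.
Qed.

Definition cycleA n : ATV A n -> Prop :=
  match n with 0 => fun _ => True | m.+1 => fun q => faceA m q \in @degen m end.

(** Surjectivity in homology. The unshuffle of a cycle is a cycle one dimension lower, for the
    shifted grading; shuffling its normal form back and applying the homotopy gives the normal form
    of [q]. *)
Lemma cycle_antisym n (D : nat -> zmodClosed A) (q : ATV A n) :
  q \in @graded D n -> cycleA q ->
  exists a r, [/\ a \in D n, r \in @graded D n.+1 &
    q - tensor a (antisym n) - faceA n r \in @degen n].
Proof.
elim: n D q => [|n IH] D q hq.
  exists q@_(FMonom [::]), 0; split; rewrite ?rpred0 //.
    by move/coefinP/(_ (FMonom [::])): hq.
  by rewrite -ATV0E subrr raddf0 subrr rpred0.
rewrite /cycleA => bq.
have cq : cycleA (unshuffleA n q).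
  case: n {IH} q hq bq => // n q hq bq.
  by rewrite /cycleA -[faceA _ _]opprK -unshuffleA_faceA rpredN unshuffleA_degen.
have [a [r [ha hr]]] := IH _ _ (unshuffleA_graded hq) cq.
(* The contraction comes from the homotopy formula; the shuffle of [r] enters with a minus sign
   because shuffling anticommutes with the face sum. *)
set d := _ - _ => hd; exists a, (contractA _ q - shuffleA _ r); split=> //.
  by rewrite rpredB ?contractA_graded ?shuffleA_graded.
have -> : q - tensor a (antisym n.+1) - faceA n.+1 (contractA n.+1 q - shuffleA n.+1 r) =
    emptyA _ q + contractA n (faceA n q) + shuffleA n d.
  rewrite /d !raddfB /= shuffleA_antisym faceA_shuffleA opprK.
  have e : q = faceA _ (contractA n.+1 q) + contractA n (faceA n q) + emptyA _ q + shuffleA n (unshuffleA n q).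
    by rewrite homotopyA addrAC subrK subrK.
  rewrite {1}e !addrA [LHS](ACl (1*6*3*2*4*5*7))%AC /= subrr add0r.
  by [].
by rewrite !rpredD ?emptyA_degen ?contractA_degen ?shuffleA_degen.
Qed.

(** Injectivity in homology. Unshuffling [n] times brings the relation down to dimension 0, where
    the face sum is zero and only zero is degenerate. *)
Lemma antisym_boundary n a (r : ATV A n.+1) :
  tensor a (antisym n) - faceA n r \in @degen n -> a = 0.
Proof.
elim: n r => [|n IH] r.
  rewrite faceA0 subr0 antisym0 => /coefinP/(_ (FMonom [::])).
  by rewrite tensorE -word0 wordE mcoeffUU mulr1z => /eqP.
by move/unshuffleA_degen; rewrite raddfB /= unshuffleA_antisym unshuffleA_faceA -raddfN => /IH.
Qed.

(** The contraction of [z] lies in dimension [n.+2] but its words have at most [n.+1] letters, so it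
    is degenerate, and so is its boundary. The other terms of the homotopy formula are degenerate as
    well. *)
Lemma top_cycle n (z : ATV A n.+1) :
  z \in coefin (fun w : {fmonom 'I_n.+1} => @zero_unless A (size w <= n.+1)%N) ->
  faceA n z \in @degen n -> z - shuffleA n (unshuffleA n z) \in @degen n.+1.
Proof.
move=> hz bz.
have -> : z - shuffleA n (unshuffleA n z) = faceA _ (contractA _ z) + contractA _ (faceA _ z) + emptyA _ z.
  by rewrite homotopyA addrAC subrK.
rewrite !rpredD ?emptyA_degen ?(contractA_degen bz) ?faceA_degen //.
apply: (short_degen (ltnSn _)).
exact: (contractA_graded (D := fun k => @zero_unless A (k <= n.+1)%N)).
Qed.

End NormalizedTensor.

(** * The mixed complex of a Fin-ring identified with Q *)

Section QMap.
Variables (A : dgRing) (n m : nat) (a : fin_hom n m).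

Definition q_map_mlin : {additive ATV A n -> ATV A m} :=
  mlin (fun w : {fmonom 'I_n} => tensl A (tv_map a << w >>) \+
    (tensl A (tv (a ord0) * tv_map a << w >>) \o dg_d A)).

Lemma q_mapE q : q_map a q = q_map_mlin q.
Proof. by apply: eq_bigr => w _; rewrite /= tensor.unlock. Qed.

Lemma q_map_word b s : q_map_mlin (tensor b (word s)) =
  tensor b (tv_map a (word s)) + tensor (dg_d A b) (tv (a ord0) * tv_map a (word s)).
Proof. by rewrite tens_word /= mlinU /= -wordE. Qed.

Lemma q_map_tensor b x : q_map_mlin (tensor b x) =
  tensor b (tv_map a x) + tensor (dg_d A b) (tv (a ord0) * tv_map a x).
Proof.
pose H : {additive TV n -> ATV A m} := (tensor b \o tv_map a) \+
  (tensor (dg_d A b) \o (tv (a ord0) \*o tv_map a)).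
have /(_ x) // : q_map_mlin \o tensor b =1 H.
by apply: TV_ext => s; rewrite [LHS]q_map_word.
Qed.

Lemma q_map_pointed q : a ord0 = ord0 -> q_map_mlin q = amap A (tv_map a) q.
Proof.
move=> a0; have /(_ q) // : q_map_mlin =1 amap A (tv_map a).
apply: ATV_ext => b s.
by rewrite q_map_word amap_word a0 tv_ord0 mul0r raddf0 addr0.
Qed.
End QMap.

Lemma words_mul n i j (x y : TV n) :
  x \in words (fun w : seq 'I_n => size w == i) ->
  y \in words (fun w : seq 'I_n => size w == j) ->
  x * y \in words (fun w : seq 'I_n => size w == (i + j)%N).
Proof.
move=> /wordsP hx /wordsP hy; rewrite malgME.
rewrite big_seq rpred_sum // => k hk; rewrite big_seq rpred_sum // => l hl.
apply: coefinU; rewrite fmM size_cat.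
rewrite (eqP (hx k _)) ?mcoeff_neq0 // (eqP (hy l _)) ?mcoeff_neq0 // eqxx.
by [].
Qed.

Lemma tv_words n i : tv i \in words (fun w : seq 'I_n => size w == 1).
Proof.
case: (unliftP ord0 i) => [k|] ->; last by rewrite tv_ord0 rpred0.
by rewrite tv_lift fmuE -wordE word_words.
Qed.

Lemma words_closed n (P : pred (seq 'I_n)) (M : zmodType) (F : {additive TV n -> M})
    (D : zmodClosed M) x :
  x \in words P -> (forall s, P s -> F (word s) \in D) -> F x \in D.
Proof.
move=> /wordsP hx h; rewrite (monalgE x) raddf_sum big_seq; apply: rpred_sum.
move=> [s] hs; rewrite /= monalgU_word raddfMz rpredMz // h // (hx (FMonom s)) //.
by rewrite mcoeff_neq0.
Qed.

Lemma tv_map_words n m (a : fin_hom n m) i x :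
  x \in words (fun w : seq 'I_n => size w == i) ->
  tv_map a x \in words (fun w : seq 'I_m => size w == i).
Proof.
move=> hx; apply: (words_closed (D := words _) hx) => s /eqP<- /=.
rewrite tv_mapE; elim: s => [|k s IH]; first by rewrite big_nil -word0 word_words.
rewrite big_cons -[size _]add1n; apply: words_mul => //.
by rewrite rpredB ?tv_words.
Qed.

Lemma tensor_graded (A : dgRing) (D : nat -> zmodClosed A) n i a (x : TV n) :
  x \in words (fun w : seq 'I_n => size w == i) -> a \in D i ->
  tensor a x \in @graded A D n.
Proof. by move=> /wordsP hx ha; apply: tens_coefin => w /hx/eqP->. Qed.

Lemma antisym_words n : antisym n \in words (fun w : seq 'I_n => size w == n).
Proof.
elim: n => [|n IH]; first by rewrite antisym0 -word0 word_words.
rewrite antisymS; apply: (words_closed (D := words _) IH) => s /eqP hs /=.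
by have /wordsP h := shuffleT_word s; apply/wordsP => w /h/andP[/eqP-> _]; rewrite hs.
Qed.

Section Identification.
Variables (A : dgRing) (S : pzRingType) (iota : {rmorphism S -> A}).
Variables (P : finRing) (inj : forall n, 'I_n.+1 -> {rmorphism S -> P n}).
Variables (phi : forall n, {additive P n -> ATV A n}).
Hypothesis phiP : Q_identification iota inj phi.

Local Notation C := (finAb_of_finRing P).
Local Notation deg := (dg_deg A).
Local Open Scope quotient_scope.

Lemma phi_graded n (x : P n) : phi n x \in @graded A deg n.
Proof. by apply/coefinP => w; apply: (qi_inQ phiP). Qed.

Lemma phi_surj n (q : ATV A n) : q \in @graded A deg n -> exists x, phi n x = q.
Proof. by move=> /coefinP hq; apply: (qi_surj phiP) => w; apply: hq. Qed.

Lemma phi_map n m (a : fin_hom n m) (x : P n) :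
  phi m (fr_map P a x) = q_map_mlin A a (phi n x).
Proof. by rewrite (qi_map phiP) q_mapE. Qed.

Lemma face_sum_codegen n (q : ATV A n.+1) :
  \sum_(i < n.+2) amap A (tv_map (codegen i)) q *~ (-1) ^+ i = faceA A n q.
Proof.
have addF : zmod_morphism (fun q : ATV A n.+1 =>
    \sum_(i < n.+2) amap A (tv_map (codegen i)) q *~ (-1) ^+ i).
  by move=> x y; rewrite -sumrB; apply: eq_bigr => i _; rewrite raddfB mulrzBl.
pose F : {additive ATV A n.+1 -> ATV A n} :=
  HB.pack (fun q : ATV A n.+1 =>
    \sum_(i < n.+2) amap A (tv_map (codegen i)) q *~ (-1) ^+ i)
   (GRing.isZmodMorphism.Build _ _ _ addF).
have /(_ q) // : F =1 faceA A n; apply: ATV_ext => a s; rewrite /F /=.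
rewrite amap_word -chain_b_TV /= /chain_b_fun raddf_sum; apply: eq_bigr => i _.
by rewrite amap_word raddfMz.
Qed.

Lemma codegen0 n (i : 'I_n.+2) : codegen i ord0 = ord0.
Proof. by apply: val_inj; rewrite /= codegenE; repeat case: ifP. Qed.

Lemma phi_chain_b n (x : P n.+1) : phi n (chain_b C n x) = faceA A n (phi n.+1 x).
Proof.
rewrite -face_sum_codegen /= /chain_b_fun raddf_sum; apply: eq_bigr => i _.
by rewrite raddfMz /= phi_map q_map_pointed // codegen0.
Qed.

Lemma coface0 n (i : 'I_n.+1) : coface (lift ord0 i) ord0 = ord0.
Proof. by rewrite ffunE; apply: val_inj. Qed.

Lemma coface_word n (i : 'I_n.+1) s :
  tv_map (coface (lift ord0 i)) (word s) = word (map (lift i) s).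
Proof.
apply: tv_map_pointed => [|k]; rewrite ?coface0 // !ffunE; apply: val_inj.
by rewrite /= /bump /=; lia.
Qed.

(** The cofaces other than [coface ord0] fix the point 0, so they only relabel letters, without a
    [d] term. Conversely, a word missing a letter is relabelled from a word of the same length; its
    coefficient therefore has the right degree to be lifted through [phi] one dimension lower. *)
Lemma phi_degenerate n (x : P n) :
  (x \in @degenerate C n) = (phi n x \in @degen A n).
Proof.
apply/idP/idP.
  case: n x => [|n] x; first by move/eqP->; rewrite raddf0 rpred0.
  move/asboolP=> [y ->]; rewrite raddf_sum rpred_sum // => i _ /=.
  rewrite phi_map q_map_pointed ?coface0 //.
  have : phi n (y i) \in coefin (fun w : {fmonom 'I_n} => @zero_unless A true).
    exact/coefinP.
  apply: amap_coefin => s w hw; apply: zero_unlessS => _; move: hw.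
  rewrite coface_word wordE mcoeffU1; case: (FMonom _ =P w) => [<- _|//] /=.
  rewrite (undup_map_inj lift_inj) size_map ltnS.
  by rewrite -[leqRHS]card_ord -(card_uniqP (undup_uniq s)) max_card.
case: n x => [|n] x hx.
  rewrite -topredE /=; apply/eqP/(qi_inj phiP); rewrite raddf0; apply/malgP => w.
  by move/coefinP/(_ w): hx; rewrite -topredE /= /zero_unless /= => /eqP->; rewrite mcoeff0.
suff [y hy /(qi_inj phiP) <-] : exists2 y, y \in @degenerate C n.+1 &
  phi n.+1 y = phi n.+1 x by [].
rewrite (monalgE (phi _ x)).
pose K (q : ATV A n.+1) := exists2 y, y \in @degenerate C n.+1 & phi n.+1 y = q.
apply: (@big_ind _ K) => [|_ _ [y hy <-] [z hz <-]|[s] _].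
- by exists 0; rewrite ?rpred0 ?raddf0.
- by exists (y + z); rewrite ?rpredD ?raddfD.
rewrite -tens_word; set a := _@__.
have [->|a0] := eqVneq a 0; first by exists 0; rewrite ?rpred0 // tens0l raddf0.
have hs : (size (undup s) < n.+1)%N.
  move/coefinP/(_ (FMonom s)): hx; rewrite -/a -topredE /= /zero_unless /=.
  by rewrite (negPf a0) orbF.
have [i /map_lift_ex[t e]] := missing_letter hs.
have ha : a \in deg (size t).
  have := qi_inQ phiP x (FMonom s); rewrite -/a /=.
  by rewrite {1}e size_map.
have [y hy] := phi_surj (tensor_graded (word_words (eqxx (size t))) ha).
exists (fr_map P (coface (lift ord0 i)) y).
  apply: (@degenerate_miss C _ _ _ (lift ord0 i)) => // k.
  by rewrite ffunE eq_sym neq_lift.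
by rewrite phi_map q_map_pointed ?coface0 // hy amap_word coface_word -e.
Qed.

Lemma norm_class_eq n (x y : P n) :
  (norm_class (x : C n) = norm_class (y : C n)) <-> x - y \in @degenerate C n.
Proof.
by split=> [/eqP|h]; [|apply/eqP]; rewrite -Quotient.idealrBE.
Qed.

Lemma antisym_preimage n (w : homog A n) :
  exists x, phi n x = tensor (val w) (antisym n).
Proof. by apply: phi_surj; apply: tensor_graded (antisym_words n) (valP w). Qed.

Definition antisym_elt n (w : homog A n) : P n := projT1 (cid (antisym_preimage w)).

Lemma phi_antisym_elt n (w : homog A n) :
  phi n (antisym_elt w) = tensor (val w) (antisym n).
Proof. by rewrite /antisym_elt; case: cid. Qed.

Fact antisym_elt_additive n : zmod_morphism (@antisym_elt n).
Proof.
move=> u v; apply: (qi_inj phiP).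
by rewrite raddfB !phi_antisym_elt raddfB tensBl.
Qed.
HB.instance Definition _ n :=
  GRing.isZmodMorphism.Build _ _ (@antisym_elt n) (@antisym_elt_additive n).

Lemma chain_b_antisym n (w : homog A n.+1) : chain_b C n (antisym_elt w) = 0.
Proof.
by apply: (qi_inj phiP); rewrite raddf0 phi_chain_b phi_antisym_elt faceA_antisym.
Qed.

Definition antisym_class n : {additive dg_mixed A n -> normalized_mixed C n} :=
  \pi_(normalized C n) \o @antisym_elt n.

Lemma antisym_class_b n (w : dg_mixed A n.+1) :
  antisym_class n (mc_b (dg_mixed A) n w) =
  mc_b (normalized_mixed C) n (antisym_class n.+1 w).
Proof.
transitivity (norm_class (chain_b C n (antisym_elt w))).
  by rewrite chain_b_antisym [LHS]raddf0 [RHS]raddf0.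
exact/esym/(quot_mapE (@chain_b_degenerate C n)).
Qed.

(** The rotation by [i] followed by the extra degeneracy sends 0 to [i.+1], so its term is [w] times
    words of length [n], which are degenerate in dimension [n.+1], plus [dw] times words of length
    [n.+1] starting with [v_(i+1)]. The unshuffle of the second kind is nonzero only for [i = n]. *)
Lemma chain_B_top n (w : homog A n) :
  let z := phi n.+1 (chain_B C n (antisym_elt w)) in
  z \in coefin (fun w : {fmonom 'I_n.+1} => @zero_unless A (size w <= n.+1)%N) /\
  unshuffleA A n z - tensor (dg_d A (val w)) (antisym n) \in @degen A n.
Proof.
pose a i : fin_hom n n.+1 :=
  fin_comp (coface ord0) [ffun k : 'I_n.+1 => inZp (k + i) : 'I_n.+1].
have a0 i : (i < n.+1)%N -> tv (a i ord0) = vn n.+1 i.+1.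
  move=> hi; rewrite /vn; congr tv; rewrite !ffunE; apply: val_inj.
  by rewrite /= add0n modn_small // inordK.
(* The last face undoes the [n]-th rotation followed by the extra degeneracy: [0] goes to [n], to
   [n.+1], and back to [0]. *)
have mu_a x : mapn n.+1 n (mu n n.+1) (tv_map (a n) x) = x.
  rewrite -[LHS](tv_map_codegen (@ord_max n.+1)) -tv_map_comp.
  have -> : fin_comp (codegen ord_max) (a n) = fin_id n; last exact: tv_map_id.
  apply/ffunP=> k; have hk := ltn_ord k; rewrite compE [RHS]ffunE; apply: val_inj.
  rewrite /= codegenE /a compE cofaceE ffunE /=.
  case: (ltnP 0 k) => k0.
    have -> : (k + n = k.-1 + n.+1)%N by lia.
    by rewrite modnDr modn_small; repeat case: ifP; lia.
  have -> : k = 0%N :> nat by lia.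
  by rewrite add0n modn_small // eqxx.
move=> z.
have -> : z = \sum_(0 <= i < n.+1) (tensor (val w) (tv_map (a i) (antisym n)) +
    tensor (dg_d A (val w)) (vn n.+1 i.+1 * tv_map (a i) (antisym n))) *~ (-1) ^+ (n * i).
  rewrite /z /= /chain_B_fun /cyc_norm !raddf_sum big_mkord; apply: eq_bigr => i _.
  rewrite iter_cycE !raddfMz -fa_comp /= phi_map phi_antisym_elt q_map_tensor.
  by rewrite a0.
have aw i := tv_map_words (a i) (antisym_words n).
have short x c : x \in words (fun w : seq 'I_n.+1 => size w == n) ->
  tensor c x \in coefin (fun w : {fmonom 'I_n.+1} => @zero_unless A (size w <= n)%N).
  by move=> hx; apply: (tensor_graded (D := fun k => @zero_unless A (k <= n)%N) hx); exact: zero_unlessT.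
split.
  rewrite big_nat_cond rpred_sum // => i /andP[/andP[_ hi] _].
  rewrite rpredMz // rpredD //.
    apply: (tensor_graded (D := fun k => @zero_unless A (k <= n.+1)%N) (aw i)).
    exact: zero_unlessT.
  apply: (tensor_graded (D := fun k => @zero_unless A (k <= n.+1)%N) (i := n.+1)).
    exact: (words_mul (tv_words _) (aw i)).
  exact: zero_unlessT.
rewrite raddf_sum.
have term i : (i < n.+1)%N -> exists2 d, d \in @degen A n &
  unshuffleA A n ((tensor (val w) (tv_map (a i) (antisym n)) +
    tensor (dg_d A (val w)) (vn n.+1 i.+1 * tv_map (a i) (antisym n))) *~ (-1) ^+ (n * i))
  = d + (if i == n then tensor (dg_d A (val w)) (antisym n) else 0).
  move=> hi; exists (unshuffleA A n (tensor (val w) (tv_map (a i) (antisym n))) *~ (-1) ^+ (n * i)).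
    by rewrite rpredMz // unshuffleA_degen // (short_degen (ltnSn n)) ?short ?aw.
  rewrite raddfMz raddfD mulrzDl; congr (_ + _).
  rewrite amap_tens unshuffleT_vn //; case: (eqVneq i n) => [->|ni]; last first.
    by rewrite eqSS (negPf ni) raddf0 mul0rz.
  (* The sign [(-1)^n] of the unshuffle meets [(-1)^(n^2)] from the cyclic norm, and [n + n^2] is
     even. *)
  rewrite eqxx raddfMz -mulrzA -exprD -mulnS -signr_odd oddM /= andbN mulr1z.
  by rewrite mu_a.
rewrite big_nat_recr //= -addrA rpredD //.
  rewrite big_nat_cond rpred_sum // => i /andP[/andP[_ hi] _].
  have [d hd ->] := term i (ltnW hi).
  by rewrite (ltn_eqF hi) addr0.
by have [d hd ->] := term n (ltnSn n); rewrite eqxx addrK.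
Qed.

(** The element [z] obtained by applying [chain_B] is a cycle because [b] kills [antisym_elt w] and
    anticommutes with [B]. By [top_cycle] it equals, modulo degenerates, the shuffle of its
    unshuffle, which [chain_B_top] identifies. *)
Lemma antisym_class_B n (w : dg_mixed A n) :
  antisym_class n.+1 (mc_B (dg_mixed A) n w) =
  mc_B (normalized_mixed C) n (antisym_class n w).
Proof.
transitivity (norm_class (chain_B C n (antisym_elt w))); last first.
  exact/esym/(quot_mapE (@chain_B_degenerate C n)).
apply/norm_class_eq; rewrite phi_degenerate raddfB.
have := chain_B_top w; cbv zeta.
have : faceA A n (phi n.+1 (chain_B C n (antisym_elt w))) \in @degen A n.
  rewrite -phi_chain_b.
  suff -> : chain_b C n (chain_B C n (antisym_elt w)) = 0 by rewrite raddf0 rpred0.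
  case: n w => [|n] w; first exact: chain_bB0.
  have := chain_bB (antisym_elt w : C n.+1).
  by rewrite chain_b_antisym [chain_B C n 0]raddf0 addr0.
set z := phi n.+1 (chain_B C n (antisym_elt w)) => bz [hz hpi].
rewrite [phi _ _]phi_antisym_elt -rpredN opprB -(subrK (shuffleA A n (unshuffleA A n z)) z).
rewrite -addrA rpredD ?top_cycle //.
by rewrite -shuffleA_antisym -raddfB shuffleA_degen.
Qed.

Definition antisym_mixed : mixedMap (dg_mixed A) (normalized_mixed C) :=
  MixedMap antisym_class_b antisym_class_B.

Lemma antisym_mixedE n (w : homog A n) (x : P n) :
  phi n x = tens (val w) (antisym n) -> antisym_mixed n w = norm_class (x : C n).
Proof.
rewrite tens_tensor -phi_antisym_elt => /(qi_inj phiP) ->.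
by [].
Qed.

Lemma class_boundary n (x : P n) (y : P n.+1) :
  norm_class (x : C n) = mc_b (normalized_mixed C) n (norm_class (y : C n.+1)) ->
  phi n x - faceA A n (phi n.+1 y) \in @degen A n.
Proof.
rewrite [mc_b _ _ _](quot_mapE (@chain_b_degenerate C n)) => /norm_class_eq.
by rewrite phi_degenerate raddfB phi_chain_b.
Qed.

Lemma HH_antisym_inj n : injective (HH_map antisym_mixed n).
Proof.
apply: raddf_inj => U; rewrite -[U]reprK; case: (generic_quotient.repr U) => w hw.
rewrite quot_mapE => /eqP; rewrite -[X in _ == X](raddf0 (\pi_(HH (normalized_mixed C) n))).
rewrite -Quotient.idealrBE subr0 => /asboolP[y'] /=.
rewrite -[y']reprK => /class_boundary.
rewrite [phi _ _]phi_antisym_elt => /antisym_boundary w0.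
suff -> : Cycle hw = 0 by rewrite raddf0.
by do 2 apply: val_inj.
Qed.

Lemma HH_antisym_surj n Y : exists U, HH_map antisym_mixed n U = Y.
Proof.
rewrite -[Y]reprK; case: (generic_quotient.repr Y) => y hy; move: hy; rewrite -[y]reprK => hy.
set x := generic_quotient.repr y in hy *.
have cx : cycleA (phi n x).
  case: n {Y} y @x hy => // n y x; rewrite -topredE /= => /eqP hy.
  rewrite /cycleA -phi_chain_b -phi_degenerate -[chain_b _ _ _]subr0.
  apply/norm_class_eq; rewrite [RHS](raddf0 (\pi_(normalized C n))) -hy.
  exact/esym/(quot_mapE (@chain_b_degenerate C n)).
have [a [r [ha hr hd]]] := cycle_antisym (phi_graded x) cx.
have [y' y'r] := phi_surj hr; pose w : homog A n := Homog ha.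
have hw : (w : dg_mixed A n) \in @is_cycle (dg_mixed A) n.
  by case: n {Y y x hy cx a r ha hr hd y' y'r} w => // n w; rewrite -topredE /=.
exists (\pi_(HH (dg_mixed A) n) (Cycle hw)); rewrite quot_mapE.
apply/eqP; rewrite -Quotient.idealrBE; apply/asboolP.
(* The sign is reversed because the relation here is for [antisym_elt w - x], whereas
   [cycle_antisym] gives the boundary of [r] as [x] minus the antisymmetrized term. *)
exists (norm_class (- y' : C n.+1)).
rewrite [RHS](quot_mapE (@chain_b_degenerate C n)).
transitivity (norm_class (antisym_elt w - x : C n)); first exact/esym/(raddfB (\pi_(normalized C n))).
apply/norm_class_eq; rewrite phi_degenerate.
have -> : phi n (antisym_elt w - x - chain_b C n (- y')) =
    - (phi n x - tensor a (antisym n) - faceA A n r).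
  rewrite (raddfN (chain_b C n)) opprK (raddfD (phi n)) (raddfB (phi n)).
  by rewrite phi_chain_b phi_antisym_elt y'r !opprB addrC.
by rewrite rpredN.
Qed.

Lemma antisym_mixed_equivalence : mixed_equivalence antisym_mixed.
Proof.
move=> n; have inv Y := cid (HH_antisym_surj (n := n) Y).
exists (fun Y => projT1 (inv Y)) => [U|Y]; last by case: (inv Y).
by case: (inv _) => V /= /HH_antisym_inj.
Qed.

End Identification.

(** * The ring structure of Q *)

Lemma theta_wordE n (s : seq 'I_n) : theta (word s) = theta_word s.
Proof. by rewrite wordE /theta mmapU mul1r. Qed.

Lemma theta_word_cons n k (s : seq 'I_n) : theta_word (k :: s) =
  vn n k.+1 * vn n k.+1 * word s - vn n k.+1 * theta_word s.
Proof.
have e : \prod_(l <- s) << fmu l >> = word s :> TV n.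
  by rewrite -word_prod; apply: eq_bigr => l _; rewrite tv_lift.
by rewrite [LHS]/= e -vn_lift tv_lift.
Qed.

Fact theta_cat_step (T : pzRingType) (v x y a b : T) m :
  v * v * (x * y) - v * (a * y + (-1) ^+ m * (x * b)) =
  (v * v * x - v * a) * y + (-1) ^+ m.+1 * (v * x * b).
Proof.
rewrite mulrBl mulrDr opprD addrA !mulrA; congr (_ + _).
by rewrite exprS mulN1r !mulNr commr_sign.
Qed.

Lemma theta_cat n (s t : seq 'I_n) : theta_word (s ++ t) =
  theta_word s * word t + (-1) ^+ size s * (word s * theta_word t).
Proof.
elim: s => [|k s IH]; first by rewrite mul0r add0r word0 !mul1r.
have -> : theta_word ((k :: s) ++ t) = vn n k.+1 * vn n k.+1 * (word s * word t) -
    vn n k.+1 * theta_word (s ++ t).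
  by rewrite wordM -theta_word_cons.
rewrite IH (theta_word_cons k s) (word_cons k s) vn_lift.
exact: theta_cat_step.
Qed.

(* [theta] precomposed with the sign [(-1)^|x|], which absorbs the sign in the
   product of [Q]. *)
Definition stheta n : {additive TV n -> TV n} :=
  lext (fun s => (-1) ^+ size s * theta_word s).

Lemma stheta_word n (s : seq 'I_n) : stheta n (word s) = (-1) ^+ size s * theta_word s.
Proof. exact: lextE. Qed.

Lemma stheta1 n : stheta n 1 = 0.
Proof. by rewrite -word0 stheta_word mulr0. Qed.

Fact stheta_mul_step (T : pzRingType) (x y a b : T) m k :
  (-1) ^+ (m + k) * (a * y + (-1) ^+ m * (x * b)) =
  (-1) ^+ k * ((-1) ^+ m * a * y) + x * ((-1) ^+ k * b).
Proof.
rewrite addnC exprD mulrDr -!mulrA; congr (_ + _).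
by rewrite signrMK [RHS]mulrA commr_sign -mulrA.
Qed.

(** Absorbing the sign moves it to the length of the right factor, so [x] may be an arbitrary,
    inhomogeneous element. *)
Lemma stheta_mul n x t :
  stheta n (x * word t) = (-1) ^+ size t * (stheta n x * word t) + x * stheta n (word t).
Proof.
pose F : {additive TV n -> TV n} := stheta n \o (word t \o* idfun).
pose H : {additive TV n -> TV n} :=
  ((-1) ^+ size t \*o (word t \o* stheta n)) \+ (stheta n (word t) \o* idfun).
have /(_ x) // : F =1 H; apply: TV_ext => s; rewrite /F /H /=.
rewrite wordM !lextE size_cat theta_cat.
exact: stheta_mul_step.
Qed.

Lemma stheta_tv n i : stheta n (tv i) = - (tv i * tv i).
Proof.
case: (unliftP ord0 i) => [k|] ->; last by rewrite tv_ord0 raddf0 mul0r oppr0.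
have e : tv (lift ord0 k) = word [:: k] by rewrite tv_lift fmuE wordE.
rewrite {1}e stheta_word theta_word_cons /= -vn_lift word0 mulr0 subr0 mulr1.
by rewrite expr1 mulN1r.
Qed.

Fact stheta2_step (T : pzRingType) (th : {additive T -> T}) (x w w2 : T) :
  (forall y, th (y * w) = - (th y * w) - y * w2) ->
  (forall y, th (y * w2) = th y * w2) -> th (th x) = 0 -> th (th (x * w)) = 0.
Proof.
move=> h h2 thx; rewrite h raddfB raddfN /= h h2 thx.
by rewrite mul0r oppr0 add0r opprK subrr.
Qed.

(** Induction on the last letter [v]. Since [stheta v = - v^2] and [stheta (v^2) = 0], applying
    [stheta] twice to [x v] leaves [stheta (stheta x) v] and two terms [stheta x v^2] of opposite
    sign. *)
Lemma stheta2 n x : stheta n (stheta n x) = 0.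
Proof.
have /(_ x) // : stheta n \o stheta n =1 \0; apply: TV_ext => s /=.
elim/last_ind: s => [|s k IH]; first by rewrite word0 stheta1 raddf0.
have e : word [:: k] = tv (lift ord0 k) :> TV n by rewrite tv_lift fmuE wordE.
have e2 : stheta n (word [:: k]) = - word [:: k; k].
  by rewrite e stheta_tv -e wordM.
have e3 : stheta n (word [:: k; k]) = 0.
  have -> : word [:: k; k] = word [:: k] * word [:: k] :> TV n by rewrite wordM.
  by rewrite stheta_mul e2 expr1 mulN1r mulrN wordM /= mulNr opprK wordM subrr.
have step y : stheta n (y * word [:: k]) =
    - (stheta n y * word [:: k]) - y * word [:: k; k].
  by rewrite stheta_mul e2 mulN1r mulrN.
have step2 y : stheta n (y * word [:: k; k]) = stheta n y * word [:: k; k].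
  by rewrite stheta_mul e3 mulr0 addr0 sqrrN expr1n mul1r.
have -> : word (rcons s k) = word s * word [:: k] by rewrite wordM cats1.
exact: stheta2_step step step2 IH.
Qed.

Lemma stheta_words n (s : seq 'I_n) :
  stheta n (word s) \in words (fun w : seq 'I_n => size w == (size s).+1).
Proof.
rewrite stheta_word; have h : theta_word s \in words (fun w : seq 'I_n => size w == (size s).+1).
  elim: s => [|k s IH]; first exact: rpred0.
  rewrite theta_word_cons rpredB //; last exact: (words_mul (tv_words _) IH).
  apply: (words_mul (words_mul (tv_words _) (tv_words _)) (word_words _)).
  exact: eqxx.
by rewrite -signr_odd; case: odd; rewrite ?mul1r // mulN1r rpredN.
Qed.

Section QMul.
Variables (A : dgRing) (n : nat).
Local Notation deg := (dg_deg A).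
Implicit Types (p q r : ATV A n).

Definition q_term (x y : {fmonom 'I_n}) (a b : A) : ATV A n :=
  tensor (a * b) (<< x >> * << y >>) +
  tensor ((-1) ^+ size x * (a * dg_d A b)) (theta << x >> * << y >>).

Fact q_term_additivel x y b : zmod_morphism (fun a => q_term x y a b).
Proof.
move=> a a'; rewrite /q_term !mulrBl mulrBr !tensBl opprD !addrA; congr (_ + _).
by rewrite addrAC.
Qed.

Fact q_term_additiver x y a : zmod_morphism (q_term x y a).
Proof.
move=> b b'; rewrite /q_term raddfB !mulrBr !tensBl opprD !addrA; congr (_ + _).
by rewrite addrAC.
Qed.

Definition q_termr x a y : {additive A -> ATV A n} :=
  HB.pack (q_term x y a)
    (GRing.isZmodMorphism.Build _ _ (q_term x y a) (q_term_additiver x y a)).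

Fact q_inner_additive x q : zmod_morphism (fun a => mlin (q_termr x a) q).
Proof.
move=> a b; rewrite /mlin -sumrB; apply: eq_bigr => y _.
exact: q_term_additivel.
Qed.

Definition q_inner q x : {additive A -> ATV A n} :=
  HB.pack (fun a => mlin (q_termr x a) q)
    (GRing.isZmodMorphism.Build _ _ (fun a => mlin (q_termr x a) q)
      (q_inner_additive x q)).

Lemma q_mulE p q : q_mul p q = mlin (q_inner q) p.
Proof.
apply: eq_bigr => x _; apply: eq_bigr => y _.
by rewrite /= /q_term !tens_tensor.
Qed.

Fact q_mul_additivel q : zmod_morphism (fun p => q_mul p q).
Proof.
move=> p p'; apply: etrans (q_mulE _ _) (etrans (raddfB (mlin (q_inner q)) p p') _).
exact: esym (f_equal2 (fun x y => x - y) (q_mulE p q) (q_mulE p' q)).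
Qed.

Fact q_mul_additiver p : zmod_morphism (q_mul p).
Proof.
move=> q q'; apply: etrans (q_mulE _ _) _.
apply: etrans (esym (f_equal2 (fun x y => x - y) (q_mulE p q) (q_mulE p q'))).
rewrite /mlin -sumrB; apply: eq_bigr => x _.
exact: (raddfB (mlin (q_termr x p@_x))).
Qed.

Definition q_mull q : {additive ATV A n -> ATV A n} :=
  HB.pack (fun p => q_mul p q)
    (GRing.isZmodMorphism.Build _ _ (fun p => q_mul p q) (q_mul_additivel q)).

Definition q_mulr p : {additive ATV A n -> ATV A n} :=
  HB.pack (q_mul p) (GRing.isZmodMorphism.Build _ _ (q_mul p) (q_mul_additiver p)).

Lemma tensor_sign k (a : A) (x : TV n) :
  tensor ((-1) ^+ k * a) x = tensor a ((-1) ^+ k * x).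
Proof.
have e (T : pzRingType) : (-1) ^+ k = (-1) ^+ odd k :> T by rewrite signr_odd.
rewrite (e A) (e (TV n)); case: (odd k); last by rewrite !mul1r.
by rewrite !mulN1r raddfN; exact: (raddfN (tensl A x)).
Qed.

Lemma q_mul_word (a b : A) s t :
  q_mul (tensor a (word s)) (tensor b (word t)) =
  tensor (a * b) (word s * word t) + tensor (a * dg_d A b) (stheta n (word s) * word t).
Proof.
have e1 : q_mul (tensor a (word s)) (tensor b (word t)) =
    tensor (a * b) (word s * word t) +
    tensor ((-1) ^+ size s * (a * dg_d A b)) (theta (word s) * word t).
  by rewrite !tens_word q_mulE mlinU /= mlinU /= /q_term !wordE.
have e2 : (-1) ^+ size s * (theta (word s) * word t) = stheta n (word s) * word t.
  by rewrite theta_wordE stheta_word mulrA.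
apply: etrans e1 (f_equal (+%R _) (etrans (tensor_sign _ _ _) _)).
exact: f_equal e2.
Qed.

Lemma q_mul_tensor (a b : A) x y :
  q_mul (tensor a x) (tensor b y) =
  tensor (a * b) (x * y) + tensor (a * dg_d A b) (stheta n x * y).
Proof.
pose F x : {additive TV n -> ATV A n} := q_mulr (tensor a x) \o tensor b.
pose H x : {additive TV n -> ATV A n} :=
  (tensor (a * b) \o (x \*o idfun)) \+ (tensor (a * dg_d A b) \o (stheta n x \*o idfun)).
have /(_ y) // : F x =1 H x; apply: TV_ext => t; rewrite /F /H /=.
pose F' : {additive TV n -> ATV A n} := q_mull (tensor b (word t)) \o tensor a.
pose H' : {additive TV n -> ATV A n} :=
  (tensor (a * b) \o (word t \o* idfun)) \+
  (tensor (a * dg_d A b) \o (word t \o* stheta n)).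
have /(_ x) // : F' =1 H'; apply: TV_ext => s; rewrite /F' /H' /=.
exact: q_mul_word.
Qed.

Lemma graded_closed (M : zmodType) (F : {additive ATV A n -> M}) (D : zmodClosed M) q :
  q \in @graded A deg n ->
  (forall a s, a \in deg (size s) -> F (tensor a (word s)) \in D) -> F q \in D.
Proof.
move=> /coefinP hq h; rewrite (monalgE q) raddf_sum; apply: rpred_sum => -[s] _.
by rewrite /= -tens_word h // (hq (FMonom s)).
Qed.

Lemma graded_ext (M : zmodType) (F H : {additive ATV A n -> M}) q :
  q \in @graded A deg n ->
  (forall a s, a \in deg (size s) -> F (tensor a (word s)) = H (tensor a (word s))) ->
  F q = H q.
Proof.
move=> /coefinP hq h; rewrite (monalgE q) !raddf_sum; apply: eq_bigr => -[s] _.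
by rewrite /= -tens_word h // (hq (FMonom s)).
Qed.

Lemma q_mul_graded p q : p \in @graded A deg n -> q \in @graded A deg n ->
  q_mul p q \in @graded A deg n.
Proof.
move=> hp hq; apply: (graded_closed (F := q_mull q) (D := @graded A deg n) hp) => a s ha.
rewrite /=; apply: (graded_closed (F := q_mulr (tensor a (word s))) (D := @graded A deg n) hq) => b t hb /=.
rewrite q_mul_word wordM rpredD //.
  apply: tensor_graded (dg_mul ha hb); apply: word_words.
  by rewrite size_cat.
apply: tensor_graded (dg_mul ha (dg_d_deg hb)); rewrite addnS -addSn.
apply: words_mul (stheta_words s) (word_words _).
exact: eqxx.
Qed.

Lemma dg_d1 : dg_d A 1 = 0.
Proof.
have := dg_leibniz 1 (dg_one A); rewrite !mulr1 expr0 !mul1r => /eqP.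
by rewrite -subr_eq0 opprD addrA subrr sub0r oppr_eq0 => /eqP.
Qed.

Lemma q_mul1l p : q_mul (tensor 1 1) p = p.
Proof.
have /(_ p) // : q_mulr (tensor 1 1) =1 idfun; apply: ATV_ext => b s /=.
by rewrite q_mul_tensor !mul1r stheta1 mul0r raddf0 addr0.
Qed.

Lemma q_mul1r p : q_mul p (tensor 1 1) = p.
Proof.
have /(_ p) // : q_mull (tensor 1 1) =1 idfun; apply: ATV_ext => b s /=.
by rewrite q_mul_tensor !mulr1 dg_d1 mulr0 tens0l addr0.
Qed.

Lemma q_mul_d (a b : A) (x y : TV n) :
  q_mul (tensor a x) (tensor (dg_d A b) y) = tensor (a * dg_d A b) (x * y).
Proof. by rewrite q_mul_tensor dg_dd mulr0 tens0l addr0. Qed.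

(** The [v_i^2] terms cancel because [stheta v_i = - v_i^2]; this is what makes [s] to [s + ds v_i]
    multiplicative on each copy of [S]. *)
Lemma q_mul_gen (a a' b : A) (i : 'I_n.+1) :
  q_mul (tensor a 1 + tensor a' (tv i)) (tensor b 1 + tensor (dg_d A b) (tv i)) =
  tensor (a * b) 1 + tensor (a' * b + a * dg_d A b) (tv i).
Proof.
set v := tv i; set X := tensor a (1 : TV n); set Y := tensor a' v.
set Z := tensor b (1 : TV n); set W := tensor (dg_d A b) v.
have e1 : q_mul X Z = tensor (a * b) 1.
  by rewrite q_mul_tensor mulr1 stheta1 mul0r raddf0 addr0.
have e2 : q_mul X W = tensor (a * dg_d A b) v by rewrite q_mul_d mul1r.
have e3 : q_mul Y Z = tensor (a' * b) v - tensor (a' * dg_d A b) (v * v).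
  by rewrite q_mul_tensor !mulr1 stheta_tv raddfN.
have e4 : q_mul Y W = tensor (a' * dg_d A b) (v * v) by exact: q_mul_d.
apply: etrans (raddfD (q_mull (Z + W)) X Y) _.
apply: etrans (f_equal2 +%R (raddfD (q_mulr X) Z W) (raddfD (q_mulr Y) Z W)) _.
apply: etrans (f_equal2 +%R (f_equal2 +%R e1 e2) (f_equal2 +%R e3 e4)) _.
by rewrite subrK -addrA -tensDl [a * _ + _]addrC.
Qed.

Fact q_mulA_step (B T : pzRingType) (M : zmodType) (F : B -> {additive T -> M})
    (a b c d_b d_c d_bc d_bdc : B) (x y z s_x s_y s_xy s_sxy : T) k :
  (forall u v w, F (u + v) w = F u w + F v w) ->
  (forall i u w, F ((-1) ^+ i * u) w = F u ((-1) ^+ i * w)) ->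
  s_xy = (-1) ^+ k * (s_x * y) + x * s_y -> s_sxy = s_x * s_y ->
  d_bc = d_b * c + (-1) ^+ k * (b * d_c) -> d_bdc = d_b * d_c ->
  F (a * b * c) (x * y * z) + F (a * b * d_c) (s_xy * z) +
  (F (a * d_b * c) (s_x * y * z) + F (a * d_b * d_c) (s_sxy * z)) =
  F (a * (b * c)) (x * (y * z)) + F (a * d_bc) (s_x * (y * z)) +
  (F (a * (b * d_c)) (x * (s_y * z)) + F (a * d_bdc) (s_x * (s_y * z))).
Proof.
move=> FD Fs -> -> -> ->.
rewrite mulrDl raddfD /= mulrDr FD [a * (_ ^+ _ * _)]mulrA commr_sign.
by rewrite -!mulrA Fs !addrA [LHS](ACl (1*4*2*3*5))%AC.
Qed.

(** The Leibniz sign is the degree of the coefficient of [q], the sign in [stheta_mul] is the length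
    of its word; homogeneity makes them agree. The second-order terms match since both [d] and
    [stheta] square to zero. *)
Lemma q_mulA p q r : q \in @graded A deg n -> q_mul (q_mul p q) r = q_mul p (q_mul q r).
Proof.
move=> hq; pose F : {additive ATV A n -> ATV A n} := q_mull r \o q_mull q.
have /(_ p) // : F =1 q_mull (q_mul q r); apply: ATV_ext => a x; rewrite /F /= {F}.
pose F : {additive ATV A n -> ATV A n} := q_mull r \o q_mulr (tensor a (word x)).
pose H : {additive ATV A n -> ATV A n} := q_mulr (tensor a (word x)) \o q_mull r.
apply: (graded_ext (F := F) (H := H) hq) => b y hb; rewrite /F /H /= {F H}.
pose F := q_mulr (q_mul (tensor a (word x)) (tensor b (word y))).
pose H : {additive ATV A n -> ATV A n} :=
  q_mulr (tensor a (word x)) \o q_mulr (tensor b (word y)).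
have /(_ r) // : F =1 H; apply: ATV_ext => c z; rewrite /F /H /= {F H}.
have eL : q_mul (q_mul (tensor a (word x)) (tensor b (word y))) (tensor c (word z)) =
    tensor (a * b * c) (word x * word y * word z) +
    tensor (a * b * dg_d A c) (stheta n (word x * word y) * word z) +
    (tensor (a * dg_d A b * c) (stheta n (word x) * word y * word z) +
     tensor (a * dg_d A b * dg_d A c) (stheta n (stheta n (word x) * word y) * word z)).
  apply: etrans (f_equal (q_mull (tensor c (word z))) (q_mul_tensor a b (word x) (word y))) _.
  apply: etrans (raddfD (q_mull (tensor c (word z))) _ _) _.
  exact: f_equal2 (q_mul_tensor _ _ _ _) (q_mul_tensor _ _ _ _).
have eR : q_mul (tensor a (word x)) (q_mul (tensor b (word y)) (tensor c (word z))) =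
    tensor (a * (b * c)) (word x * (word y * word z)) +
    tensor (a * dg_d A (b * c)) (stheta n (word x) * (word y * word z)) +
    (tensor (a * (b * dg_d A c)) (word x * (stheta n (word y) * word z)) +
     tensor (a * dg_d A (b * dg_d A c)) (stheta n (word x) * (stheta n (word y) * word z))).
  apply: etrans (f_equal (q_mulr (tensor a (word x))) (q_mul_tensor b c (word y) (word z))) _.
  apply: etrans (raddfD (q_mulr (tensor a (word x))) _ _) _.
  exact: f_equal2 (q_mul_tensor _ _ _ _) (q_mul_tensor _ _ _ _).
apply: etrans eL (etrans _ (esym eR)).
apply: (@q_mulA_step _ _ _ (@tensor A n) a b c _ _ _ _ _ _ _ _ _ _ _ (size y)).
- by move=> *; apply: tensDl.
- exact: tensor_sign.
- exact: stheta_mul.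
- by rewrite stheta_mul stheta2 mul0r mulr0 add0r.
- exact: dg_leibniz.
- by rewrite (dg_leibniz _ hb) dg_dd !mulr0 addr0.
Qed.

(** Makes [Q^n A] a ring in its own right, as a target for the universal property of the
    coproduct. *)
Record qring := QRing { qval : ATV A n; _ : qval \in @graded A deg n }.

HB.instance Definition _ := [isSub for qval].
HB.instance Definition _ := [Choice of qring by <:].
HB.instance Definition _ := [SubChoice_isSubZmodule of qring by <:].

Definition qring_mul (x y : qring) : qring := QRing (q_mul_graded (valP x) (valP y)).

Fact qring_one_graded : tensor 1 1 \in @graded A deg n.
Proof. by rewrite -word0; apply: tensor_graded (dg_one A); apply: word_words. Qed.

Fact qring_mulA : associative qring_mul.
Proof. by move=> x y z; apply: val_inj; rewrite /= q_mulA // (valP y). Qed.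

Fact qring_mul1l : left_id (QRing qring_one_graded) qring_mul.
Proof. by move=> x; apply: val_inj; rewrite /= q_mul1l. Qed.

Fact qring_mul1r : right_id (QRing qring_one_graded) qring_mul.
Proof. by move=> x; apply: val_inj; rewrite /= q_mul1r. Qed.

Fact qring_mulDl : left_distributive qring_mul +%R.
Proof. by move=> x y z; apply: val_inj; exact: (raddfD (q_mull (val z))). Qed.

Fact qring_mulDr : right_distributive qring_mul +%R.
Proof. by move=> x y z; apply: val_inj; exact: (raddfD (q_mulr (val x))). Qed.

HB.instance Definition _ := GRing.Zmodule_isPzRing.Build qring
  qring_mulA qring_mul1l qring_mul1r qring_mulDl qring_mulDr.
End QMul.

(** * The coproduct is Q of the relative forms *)

Lemma prod_enum_ord (T : pzRingType) m (F : 'I_m -> T) :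
  \prod_(j <- enum 'I_m) F j = \prod_(j < m) F j.
Proof. by rewrite enumT [index_enum _]unlock. Qed.

Section OrderedProduct.
Variables (R S T : pzRingType) (f : {rmorphism R -> S}) (u : R -> T) (m : nat).
Variable G : 'I_m.+1 -> {additive S -> T}.

Definition slot_prod (x : {ffun 'I_m.+1 -> S}) : T := \prod_(i < m.+1) G i (x i).

Lemma slot_prodE x : slot_prod x =
  \prod_(0 <= i < m.+1) G (inord i) (x (inord i)).
Proof. by rewrite big_mkord; apply: eq_bigr => i _; rewrite inord_val. Qed.

Lemma slot_prod_upd x (k : 'I_m.+1) s : slot_prod (upd x k s) =
  \prod_(0 <= i < k) G (inord i) (x (inord i)) *
  (G k s * \prod_(k.+1 <= i < m.+1) G (inord i) (x (inord i))).
Proof.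
have hk := ltn_ord k; rewrite slot_prodE (@big_cat_nat _ _ _ k) //=; last exact: ltnW.
rewrite [X in _ * X]big_ltn // inord_val ffunE eqxx; congr (_ * (_ * _)).
  apply: eq_big_nat => i /andP[_ hi]; rewrite /upd ffunE -val_eqE /= inordK; last lia.
  by rewrite ltn_eqF.
apply: eq_big_nat => i /andP[hi hi']; rewrite /upd ffunE -val_eqE /= inordK; last lia.
by rewrite gtn_eqF.
Qed.

(** Serves both for the forms themselves, with values in [A], and for the products in [P n] that
    define the inverse of the identification; [u] is the image of [R] in the target. *)
Lemma slot_prod_multimap :
  (forall i s r, G i (s * f r) = G i s * u r) ->
  (forall (i : 'I_m) r s, G (lift ord0 i) (f r * s) = u r * G (lift ord0 i) s) ->
  (forall (i : 'I_m) r, G (lift ord0 i) (f r) = 0) ->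
  form_multimap f slot_prod.
Proof.
move=> Gr Gl G0; split=> [x k s t|x k r|x k r].
- by rewrite !slot_prod_upd raddfD mulrDl mulrDr.
- rewrite !slot_prod_upd /= /bump /= add1n Gr Gl [in RHS](@big_nat_recr _ _ _ k) //=.
  rewrite [X in _ * (_ * X) = _]big_ltn ?ltnS ?ltn_ord //.
  have -> : inord k = widen_ord (leqnSn m) k.
    by apply: val_inj; rewrite /= inordK // ltnS ltnW.
  have -> : inord k.+1 = lift ord0 k.
    by apply: val_inj; rewrite /= inordK // ltnS.
  by rewrite !mulrA.
- by rewrite slot_prod_upd G0 mul0r mulr0.
Qed.
End OrderedProduct.

Section RelativeForms.
Variables (R S : pzRingType) (f : {rmorphism R -> S}).
Variables (A : dgRing) (iota : {rmorphism S -> A}).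
Hypothesis formsP : relative_forms f iota.
Local Notation deg := (dg_deg A).
Local Notation d := (dg_d A).

Lemma d_prod I (r : seq I) (F : I -> S) : d (\prod_(i <- r) d (iota (F i))) = 0.
Proof.
elim: r => [|i r IH]; first by rewrite big_nil dg_d1.
rewrite big_cons (dg_leibniz _ (dg_d_deg (rf_deg0 formsP _))).
by rewrite dg_dd IH mul0r !mulr0 addr0.
Qed.

Lemma form_deg m (x : {ffun 'I_m.+1 -> S}) : Defs.form iota x \in deg m.
Proof.
apply: (@dg_mul A 0 m); first exact: (rf_deg0 formsP).
have h k (F : 'I_k -> S) : \prod_(i < k) d (iota (F i)) \in deg k; last exact: h.
elim: k F => [|k IH] F; first by rewrite big_ord0 dg_one.
rewrite big_ord_recl; apply: (@dg_mul A 1 k); last exact: IH.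
exact: dg_d_deg (rf_deg0 formsP _).
Qed.

Definition hform m (x : {ffun 'I_m.+1 -> S}) : homog A m := Homog (form_deg x).

Lemma form_multimap_form m : form_multimap f (fun x : {ffun 'I_m.+1 -> S} => Defs.form iota x).
Proof.
pose G (i : 'I_m.+1) : {additive S -> A} :=
  if i == ord0 then iota : {additive S -> A} else d \o iota.
suff [h1 h2 h3] : form_multimap f (slot_prod G).
  have e x : Defs.form iota x = slot_prod G x by rewrite /slot_prod big_ord_recl.
  by split=> *; rewrite !e.
apply: (slot_prod_multimap (u := iota \o f)) => [i s r|i r s|i r]; rewrite /G /=.
- case: ifP => _ /=; rewrite rmorphM //= (dg_leibniz _ (rf_deg0 formsP _)).
  by rewrite (rf_d formsP) !mulr0 addr0.
- by rewrite rmorphM (dg_leibniz _ (rf_deg0 formsP _)) (rf_d formsP) mul0r add0r mul1r.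
- exact: (rf_d formsP).
Qed.

(** The products [s_0 ds_1 .. ds_m] generate [A^m]: both maps satisfy the uniqueness clause of
    [rf_tensor] for the same multimap. *)
Lemma homog_ext m (M : zmodType) (F H : {additive homog A m -> M}) :
  (forall x, F (hform x) = H (hform x)) -> F =1 H.
Proof.
move=> FH; have [h1 h2 h3] := form_multimap_form m.
have mF : form_multimap f (fun x => F (hform x)).
  split=> [x k s t|x k r|x k r].
  - by rewrite -raddfD; congr (F _); apply: val_inj; apply: h1.
  - by congr (F _); apply: val_inj; apply: h2.
  - by rewrite -[RHS](raddf0 F); congr (F _); apply: val_inj; apply: h3.
have [g _ gP] := rf_tensor formsP mF.
have e (x : {ffun 'I_m.+1 -> S}) w : val w = Defs.form iota x -> w = hform x.
  by move=> ?; apply: val_inj.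
by move=> w; rewrite (gP F) ?(gP H) // => x v /e ->.
Qed.

(** * Generators of the coproduct and the isomorphism with [Q] *)

Section Coproduct.
Variables (P : finRing) (inj : forall n, 'I_n.+1 -> {rmorphism S -> P n}).
Hypothesis coprodP : coproduct_finRing f inj.

Section Generation.
Variables (n : nat) (D : subringClosed (P n)).
Hypothesis injD : forall (i : 'I_n.+1) s, inj i s \in D.

Record gsub := Gsub { gsub_val : P n; _ : gsub_val \in D }.
HB.instance Definition _ := [isSub for gsub_val].
HB.instance Definition _ := [Choice of gsub by <:].
HB.instance Definition _ :=
  GRing.SubChoice_isSubPzRing.Build (P n) (mem D) gsub (subringClosedP D).

Definition gsub_inj (i : 'I_n.+1) (x : S) : gsub := Gsub (injD i x).

Fact gsub_inj_zmod i : zmod_morphism (gsub_inj i).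
Proof. by move=> s t; apply: val_inj; rewrite /= raddfB. Qed.

Fact gsub_inj_monoid i : monoid_morphism (gsub_inj i).
Proof.
by split=> [|s t]; apply: val_inj; rewrite /= ?rmorph1 ?rmorphM.
Qed.

HB.instance Definition _ i := GRing.isZmodMorphism.Build _ _ (gsub_inj i) (gsub_inj_zmod i).
HB.instance Definition _ i := GRing.isMonoidMorphism.Build _ _ (gsub_inj i) (gsub_inj_monoid i).

(** The universal property gives a map from [P n] into the subring [D]; followed by the inclusion it
    fixes every copy of [S], hence is the identity. *)
Lemma coproduct_generated y : y \in D.
Proof.
have e0 i r : gsub_inj i (f r) = gsub_inj ord0 (f r).
  by apply: val_inj; exact: (cp_under coprodP).
have [h hP _] := cp_univ coprodP (T := gsub)
  (u := (gsub_inj ord0 : {rmorphism S -> gsub}) \o f) (g := fun i => gsub_inj i)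
  e0.
have [k _ kP] := cp_univ coprodP (T := P n) (u := inj (ord0 : 'I_n.+1) \o f) (g := @inj n)
  (fun i r => cp_under coprodP i ord0 r).
have e : val \o h =1 idfun.
  move=> z; rewrite (kP (val \o h)) ?(kP idfun) // => i s /=.
  by rewrite hP.
by rewrite -[y]e; apply: valP.
Qed.
End Generation.

Section Span.
Variable n : nat.
Local Notation in0 := (inj (ord0 : 'I_n.+1)).

Definition delta (k : 'I_n) s : P n := inj (lift ord0 k) s - in0 s.

Definition monoP (s0 : S) (l : seq ('I_n * S)) : P n :=
  in0 s0 * \prod_(p <- l) delta p.1 p.2.

Lemma monoP_nil s0 : monoP s0 [::] = in0 s0.
Proof. by rewrite /monoP big_nil mulr1. Qed.

Lemma monoP_rcons s0 l k s : monoP s0 (rcons l (k, s)) = monoP s0 l * delta k s.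
Proof. by rewrite /monoP -cats1 big_cat big_seq1 mulrA. Qed.

Definition spanP : {pred P n} :=
  fun x => `[< exists L, x = \sum_(p <- L) monoP p.1 p.2 >].

Fact spanP_closed : zmod_closed spanP.
Proof.
split; first by apply/asboolP; exists [::]; rewrite big_nil.
move=> _ _ /asboolP[L ->] /asboolP[L' ->]; apply/asboolP.
exists (L ++ [seq (- p.1, p.2) | p <- L']); rewrite big_cat big_map -sumrN.
congr (_ + _); apply: eq_bigr => p _.
by rewrite /monoP rmorphN mulNr.
Qed.
HB.instance Definition _ := GRing.isZmodClosed.Build _ spanP spanP_closed.

Lemma monoP_span s0 l : monoP s0 l \in spanP.
Proof. by apply/asboolP; exists [:: (s0, l)]; rewrite big_seq1. Qed.

Lemma span_mulr y : (forall s0 l, monoP s0 l * y \in spanP) ->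
  forall x, x \in spanP -> x * y \in spanP.
Proof. by move=> h _ /asboolP[L ->]; rewrite mulr_suml rpred_sum. Qed.

Lemma span_delta k s x : x \in spanP -> x * delta k s \in spanP.
Proof. by apply: span_mulr => s0 l; rewrite -monoP_rcons monoP_span. Qed.

(* [delta k] is a derivation from [in0] to [inj k], so [in0 t] can be moved to
   the left through [delta k s]. *)
Lemma delta_in0 k s t :
  delta k s * in0 t = delta k (s * t) - delta k s * delta k t - in0 s * delta k t.
Proof.
rewrite -addrA -opprD -mulrDl /delta subrK !rmorphM mulrBr opprB [RHS]addrC.
by rewrite addrA subrK mulrBl.
Qed.

Lemma span_in0 t x : x \in spanP -> x * in0 t \in spanP.
Proof.
apply: span_mulr => s0 l; elim/last_ind: l t => [|l [k s] IH] t.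
  by rewrite monoP_nil -rmorphM -monoP_nil monoP_span.
rewrite monoP_rcons -mulrA delta_in0 2!mulrBr !mulrA.
by do ![apply: rpredB | apply: span_delta | apply: monoP_span | apply: IH].
Qed.

(** Right multipliers preserving the span form a subring even before the span is known to be one.
    Once it contains the generators it is everything, and multiplying [1] shows that the span is
    full. *)
Definition stabP : {pred P n} := fun y => `[< forall x, x \in spanP -> x * y \in spanP >].

Fact stabP_closed : subring_closed stabP.
Proof.
split; first by apply/asboolP => x; rewrite mulr1.
  move=> y z /asboolP hy /asboolP hz; apply/asboolP => x hx.
  by rewrite mulrBr rpredB ?hy ?hz.
move=> y z /asboolP hy /asboolP hz; apply/asboolP => x hx.
by rewrite mulrA hz ?hy.
Qed.
HB.instance Definition _ := GRing.isSubringClosed.Build _ stabP stabP_closed.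

Lemma spanP_full y : y \in spanP.
Proof.
have /asboolP h : y \in stabP.
  apply: coproduct_generated => i s; apply/asboolP => x hx.
  case: (unliftP ord0 i) => [k|] ->; last exact: span_in0.
  by rewrite -[inj _ s](subrK (in0 s)) mulrDr rpredD ?span_delta ?span_in0.
by rewrite -[y]mul1r h // -(rmorph1 in0) -monoP_nil monoP_span.
Qed.

Lemma coproduct_ext (M : zmodType) (F H : {additive P n -> M}) :
  (forall s0 l, F (monoP s0 l) = H (monoP s0 l)) -> F =1 H.
Proof.
move=> FH y; have /asboolP[L ->] := spanP_full y.
by rewrite !raddf_sum; apply: eq_bigr => p _; apply: FH.
Qed.

Local Notation deg := (dg_deg A).

Fact gen_graded (i : 'I_n.+1) s :
  tensor (iota s) 1 + tensor (dg_d A (iota s)) (tv i) \in @graded A deg n.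
Proof.
have h := rf_deg0 formsP s; rewrite rpredD //.
  by rewrite -word0; apply: tensor_graded h; apply: word_words.
by apply: tensor_graded (dg_d_deg h); apply: tv_words.
Qed.

Definition q_gen (i : 'I_n.+1) s : qring A n := QRing (gen_graded i s).

Fact q_gen_zmod i : zmod_morphism (q_gen i).
Proof.
move=> s t; apply: val_inj; rewrite /= !raddfB /= !tensBl opprD !addrA.
by rewrite [LHS](ACl (1*3*2*4))%AC.
Qed.

Fact q_gen_monoid i : monoid_morphism (q_gen i).
Proof.
split; first by apply: val_inj; rewrite /= rmorph1 dg_d1 tens0l addr0.
move=> s t; apply: val_inj.
rewrite /= rmorphM (dg_leibniz _ (rf_deg0 formsP s)) mul1r.
exact/esym/q_mul_gen.
Qed.

HB.instance Definition _ i := GRing.isZmodMorphism.Build _ _ (q_gen i) (q_gen_zmod i).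
HB.instance Definition _ i := GRing.isMonoidMorphism.Build _ _ (q_gen i) (q_gen_monoid i).

Fact q_gen_under i r : q_gen i (f r) = q_gen ord0 (f r).
Proof. by apply: val_inj; rewrite /= (rf_d formsP) !tens0l. Qed.

Lemma q_hom_ex : exists h : {rmorphism P n -> qring A n},
  forall i s, h (inj i s) = q_gen i s.
Proof.
have [h hP _] := cp_univ coprodP (T := qring A n)
  (u := (q_gen ord0 : {rmorphism S -> qring A n}) \o f) (g := fun i => q_gen i)
  q_gen_under.
by exists h.
Qed.

Definition q_hom : {rmorphism P n -> qring A n} := projT1 (cid q_hom_ex).

Lemma q_homE i s : q_hom (inj i s) = q_gen i s.
Proof. by rewrite /q_hom; case: cid. Qed.

Definition q_phi : {additive P n -> ATV A n} := val \o q_hom.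

Lemma q_phi_mul x y : q_phi (x * y) = q_mul (q_phi x) (q_phi y).
Proof. by rewrite /q_phi /= rmorphM. Qed.

Lemma q_phi_gen i s :
  q_phi (inj i s) = tensor (iota s) 1 + tensor (d (iota s)) (tv i).
Proof. by rewrite /q_phi /= q_homE. Qed.

Lemma q_phi_diff i j s :
  q_phi (inj i s - inj j s) = tensor (d (iota s)) (tv i - tv j).
Proof. by rewrite raddfB !q_phi_gen raddfB /= opprD addrACA subrr add0r. Qed.

(** Differences of two copies have closed coefficients, so multiplying by them on the right produces
    no [theta] term. The base copy [j] is arbitrary because a set map may move the point 0. *)
Lemma q_phi_prod j s0 (l : seq ('I_n.+1 * S)) :
  q_phi (inj j s0 * \prod_(p <- l) (inj p.1 p.2 - inj j p.2)) =
  tensor (iota s0 * \prod_(p <- l) d (iota p.2)) (\prod_(p <- l) (tv p.1 - tv j)) +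
  tensor (d (iota s0) * \prod_(p <- l) d (iota p.2))
    (tv j * \prod_(p <- l) (tv p.1 - tv j)).
Proof.
elim/last_ind: l => [|l [k s] IH].
  by rewrite !big_nil !mulr1 q_phi_gen.
rewrite -cats1 !big_cat !big_seq1 /= !mulrA.
apply: etrans (q_phi_mul _ _) _.
apply: etrans (f_equal2 (@q_mul A n) IH (q_phi_diff k j s)) _.
apply: etrans (raddfD (q_mull _) _ _) _.
exact: f_equal2 (q_mul_d _ _ _ _) (q_mul_d _ _ _ _).
Qed.

Lemma q_phi_monoP s0 l : q_phi (monoP s0 l) =
  tensor (iota s0 * \prod_(p <- l) d (iota p.2)) (word (map fst l)).
Proof.
have := q_phi_prod ord0 s0 [seq (lift ord0 p.1, p.2) | p <- l].
rewrite !big_map /= => ->; rewrite tv_ord0 mul0r (raddf0 (tensor _)) addr0; congr (tensor _ _).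
by rewrite -word_prod big_map; apply: eq_bigr => p _; rewrite subr0.
Qed.

Section Psi.
Variable s : seq 'I_n.

Definition psi_slot (i : 'I_(size s).+1) : {additive S -> P n} :=
  if unlift ord0 i is Some j
  then inj (lift ord0 (tnth (in_tuple s) j)) \- in0
  else in0 : {additive S -> P n}.

Lemma psi_slot0 x : psi_slot ord0 x = in0 x.
Proof. by rewrite /psi_slot unlift_none. Qed.

Lemma psi_slotS j x : psi_slot (lift ord0 j) x = delta (tnth (in_tuple s) j) x.
Proof. by rewrite /psi_slot liftK. Qed.

Lemma psi_slot_prod x : slot_prod psi_slot x =
  monoP (x ord0) [seq (tnth (in_tuple s) j, x (lift ord0 j)) | j <- enum 'I_(size s)].
Proof.
rewrite /slot_prod /monoP big_ord_recl psi_slot0 big_map prod_enum_ord /=.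
by congr (_ * _); apply: eq_bigr => j _; rewrite psi_slotS.
Qed.

(** All copies agree on [R], so each [delta k] kills [R] and is linear over it on both sides. *)
Lemma psi_multimap : form_multimap f (slot_prod psi_slot).
Proof.
have under k r : inj k (f r) = in0 (f r) := cp_under coprodP _ _ _.
apply: (slot_prod_multimap (u := in0 \o f)) => [i t r|i r t|i r] /=.
- case: (unliftP ord0 i) => [j|] ->; rewrite ?psi_slot0 ?psi_slotS /delta !rmorphM //.
  by rewrite under mulrBl.
- by rewrite !psi_slotS /delta !rmorphM under mulrBr.
- by rewrite psi_slotS /delta under subrr.
Qed.

Lemma psi_ex : exists g : {additive homog A (size s) -> P n},
  forall x, g (hform x) = slot_prod psi_slot x.
Proof.
by have [g gP _] := rf_tensor formsP psi_multimap; exists g => x; apply: gP.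
Qed.

Definition psi : {additive homog A (size s) -> P n} := projT1 (cid psi_ex).

Lemma psiE x : psi (hform x) = slot_prod psi_slot x.
Proof. by rewrite /psi; case: cid. Qed.

Lemma q_phi_psi w : q_phi (psi w) = tensor (val w) (word s).
Proof.
have e x : q_phi (psi (hform x)) = tensor (Defs.form iota x) (word s).
  rewrite psiE psi_slot_prod q_phi_monoP big_map prod_enum_ord -map_comp.
  by rewrite (map_tnth_enum (in_tuple s)).
pose H : {additive homog A (size s) -> ATV A n} := tensl A (word s) \o val.
have /(_ w) // : q_phi \o psi =1 H; apply: homog_ext => x; exact: e.
Qed.
End Psi.

Lemma q_phi_surj q : q \in @graded A deg n -> exists x, q_phi x = q.
Proof.
move=> /coefinP hq; pose K q := exists x, q_phi x = q.
rewrite (monalgE q); apply: (@big_ind _ K) => [|_ _ [x <-] [y <-]|[s] _].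
- by exists 0; rewrite raddf0.
- by exists (x + y); rewrite raddfD.
by exists (psi s (Homog (hq (FMonom s)))); rewrite q_phi_psi tens_word.
Qed.

Definition qcoef (q : qring A n) (w : {fmonom 'I_n}) : homog A (size w) :=
  Homog (coefinP _ _ (valP q) w).

Definition Psi (q : qring A n) : P n :=
  \sum_(w <- msupp (val q)) psi w (qcoef q w).

(** The type of a coefficient depends on its word, which rules out [mlin]; additivity of [Psi] is
    instead proved by summing over a common finite set of words. *)
Lemma PsiEw (D : {fset {fmonom 'I_n}}) q : (msupp (val q) `<=` D)%fset ->
  Psi q = \sum_(w <- D) psi w (qcoef q w).
Proof.
move=> le; rewrite /Psi (big_fset_incl _ le) // => w _ /mcoeff_outdom e.
have -> : qcoef q w = 0 by apply: val_inj.
exact: raddf0.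
Qed.

Fact Psi_additive : zmod_morphism Psi.
Proof.
move=> p q; pose D := (msupp (val p) `|` msupp (val q))%fset.
have le : (msupp (val (p - q)) `<=` D)%fset by exact: (msuppB_le (val p) (val q)).
have lep : (msupp (val p) `<=` D)%fset by apply: fsubsetUl.
have leq : (msupp (val q) `<=` D)%fset by apply: fsubsetUr.
apply: etrans (PsiEw le) _.
apply: etrans (esym (f_equal2 (fun x y => x - y) (PsiEw lep) (PsiEw leq))).
rewrite -sumrB; apply: eq_bigr => w _; apply: etrans (raddfB (psi w) _ _).
apply: f_equal; apply: val_inj; exact: mcoeffB.
Qed.
HB.instance Definition _ := GRing.isZmodMorphism.Build _ _ Psi Psi_additive.

Lemma psi_monoP s0 l (w : homog A (size (map fst l))) :
  val w = iota s0 * \prod_(p <- l) d (iota p.2) -> psi _ w = monoP s0 l.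
Proof.
move=> hw; pose x : {ffun 'I_(size (map fst l)).+1 -> S} :=
  [ffun i => if unlift ord0 i is Some j then nth s0 (map snd l) j else s0].
have xE (T : pzRingType) (F : 'I_n -> S -> T) :
    \prod_(j < size (map fst l)) F (tnth (in_tuple (map fst l)) j) (x (lift ord0 j)) =
    \prod_(p <- l) F p.1 p.2.
  (* A default element for [nth] must be taken from the list, since ['I_n] may be empty. *)
  case: l {w hw} @x => [|p0 l]; first by rewrite big_nil; exact: big_ord0.
  set l1 := p0 :: l => x; rewrite (big_nth p0) -(size_map fst l1) big_mkord.
  apply: eq_bigr => j _; rewrite ffunE liftK.
  have -> : tnth (in_tuple (map fst l1)) j = nth p0.1 (map fst l1) j by exact: tnth_nth.
  have hj : (j < size l1)%N by rewrite -(size_map fst l1).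
  by rewrite !(nth_map p0).
have -> : w = hform x.
  apply: val_inj; rewrite hw /= /Defs.form ffunE unlift_none; congr (_ * _).
  by rewrite -(xE _ (fun _ t => d (iota t))).
rewrite psiE /slot_prod big_ord_recl psi_slot0 ffunE unlift_none; congr (_ * _).
by rewrite -(xE _ delta); apply: eq_bigr => j _; rewrite psi_slotS.
Qed.

Lemma Psi_q_hom x : Psi (q_hom x) = x.
Proof.
have /(_ x) // : Psi \o q_hom =1 idfun; apply: coproduct_ext => s0 l /=.
have e : val (q_hom (monoP s0 l)) =
  << iota s0 * \prod_(p <- l) d (iota p.2) *g FMonom (map fst l) >>.
  by rewrite -tens_word -q_phi_monoP.
rewrite (PsiEw (D := [fset FMonom (map fst l)]%fset)); last by rewrite e msuppU_le.
by rewrite big_seq_fset1; apply: psi_monoP; rewrite /= e mcoeffUU.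
Qed.

(** [insubd 0] rebuilds the element of [qring] from its value; on values of [q_phi] the default is
    never reached. *)
Lemma q_phi_inj : injective q_phi.
Proof. by apply: (can_inj (g := fun q => Psi (insubd 0 q))) => x; rewrite valKd Psi_q_hom. Qed.

End Span.

(** On a spanning product, [a] moves the base copy from 0 to [a ord0], and [q_phi_prod] then gives a
    second term with [ds_0 ds_1 .. ds_m]. This is the differential of the coefficient, as required
    by [q_map]. *)
Lemma q_phi_map n m (a : fin_hom n m) x :
  q_phi m (fr_map P a x) = q_map a (q_phi n x).
Proof.
rewrite q_mapE.
have e s0 l : q_phi m (fr_map P a (monoP s0 l)) = q_map_mlin A a (q_phi n (monoP s0 l)).
  have -> : fr_map P a (monoP s0 l) = inj (a ord0) s0 *
      \prod_(p <- [seq (a (lift ord0 p.1), p.2) | p <- l]) (inj p.1 p.2 - inj (a ord0) p.2).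
    rewrite /monoP rmorphM rmorph_prod big_map /= (cp_map coprodP); congr (_ * _).
    by apply: eq_bigr => p _; rewrite rmorphB /= !(cp_map coprodP).
  rewrite q_phi_prod q_phi_monoP q_map_tensor !big_map tv_mapE big_map.
  by rewrite (dg_leibniz _ (rf_deg0 formsP s0)) d_prod !mulr0 addr0.
pose F : {additive P n -> ATV A m} := q_phi m \o fr_map P a.
pose H : {additive P n -> ATV A m} := q_map_mlin A a \o q_phi n.
have /(_ x) // : F =1 H; apply: coproduct_ext => s0 l; exact: e.
Qed.

Lemma q_phi_identification : Q_identification iota inj q_phi.
Proof.
split=> [n x w|n|n q hq|n|n x y|n m a x|n i s].
- by have /coefinP := valP (q_hom n x).
- exact: q_phi_inj.
- by apply: q_phi_surj; apply/coefinP.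
- by rewrite /q_phi /= rmorph1 /q_one tens_tensor.
- exact: q_phi_mul.
- exact: q_phi_map.
- by rewrite q_phi_gen !tens_tensor.
Qed.

End Coproduct.
End RelativeForms.

Theorem corollary7p7 :
  forall (R S : pzRingType) (f : {rmorphism R -> S})
    (* Omega_R S *)
    (Omega : dgRing) (iota : {rmorphism S -> Omega}),
    relative_forms f iota ->
  forall (* the coproduct of S over R *)
    (P : finRing) (inj : forall n, 'I_n.+1 -> {rmorphism S -> P n}),
    coproduct_finRing f inj ->
  (exists phi : forall n, {additive P n -> ATV Omega n},
     Q_identification iota inj phi) /\
  (forall phi : forall n, {additive P n -> ATV Omega n},
     Q_identification iota inj phi ->
     exists l : mixedMap (dg_mixed Omega)
                         (normalized_mixed (finAb_of_finRing P)),
       (forall n (w : homog Omega n) (x : P n),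
          phi n x = tens (val w) (antisym n) ->
          l n w = norm_class (x : finAb_of_finRing P n)) /\
       mixed_equivalence l).

Proof.
move=> R S f Omega iota formsP P inj coprodP; split.
  by exists (q_phi formsP coprodP); apply: q_phi_identification.
move=> phi phiP; exists (antisym_mixed phiP); split; last first.
  exact: antisym_mixed_equivalence.
by move=> n w x; apply: antisym_mixedE.
Qed.
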